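(* Consider the following algorithm for minimum bisection. Given a graph $G$ on $n$ nodes ($n$ even) with signed adjacency matrix $B$, use the quasi-linear time algorithm of Abbe and Sandon (2015) for recovery in the stochastic block model to produce a candidate bisection $x_\ast\in\{\pm1\}^n$. If $x_\ast^T\mathbf{1}=0$ and $$\lambda_2\left(D_{\mathrm{diag}(x_\ast)B\,\mathrm{diag}(x_\ast)}-B\right)>0,$$ output ''$x_\ast$ is the minimum bisection''. If not, output ''Not sure whether $x_\ast$ is the minimum bisection''. This algorithm is a Probably Certifiably Correct (PCC) algorithm for minimum bisection under the stochastic block model $\mathcal{G}(n,p,q)$ with $p=\alpha\frac{\log n}{n}$ and $q=\beta\frac{\log n}{n}$, in the regime of parameters $\sqrt{\alpha}-\sqrt{\beta}>\sqrt{2}$.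
   Context: Stochastic block model with two communities: for $n$ even and $0\le q<p\le 1$, a random graph $G$ is drawn from $\mathcal{G}(n,p,q)$ if it has $n$ nodes, divided into two clusters of $n/2$ nodes each, and for each pair of vertices $i,j$, $(i,j)$ is an edge of $G$ with probability $p$ if $i$ and $j$ are in the same cluster and with probability $q$ otherwise, independently of any other edge. Signed adjacency matrix: if $A$ is the adjacency matrix of $G$, $\mathbf{1}$ the all-ones vector and $I$ the identity matrix, then $B=2A-(\mathbf{1}\mathbf{1}^T-I)$. Minimum bisection problem for $G$: maximize $x^TBx$ over $x\in\mathbb{R}^n$ subject to $x_i^2=1$ for all $i$ and $\sum_{i=1}^n x_i=0$. The $\pm1$ entries of $x$ encode cluster memberships; $x$ and $-x$ represent the same bisection. For $x\in\{\pm1\}^n$, $\mathrm{diag}(x)$ is the diagonal matrix whose diagonal is $x$, and $D_{\mathrm{diag}(x)B\,\mathrm{diag}(x)}$ is the diagonal matrix whose $i$-th diagonal entry is $\sum_{j=1}^n[\mathrm{diag}(x)B\,\mathrm{diag}(x)]_{ij}=x_i\sum_{j=1}^nB_{ij}x_j$. For a symmetric matrix $M$, $\lambda_2(M)$ denotes its second smallest eigenvalue. The algorithm of Abbe and Sandon used in the first step is a specific algorithm from the literature, running in quasi-linear time, which is known to be a probabilistic algorithm for minimum bisection under this stochastic block model in the regime $\sqrt{\alpha}-\sqrt{\beta}>\sqrt{2}$; that is, with high probability over the input graph it finds an optimal solution. PCC algorithm: given an optimization problem that depends on an input and a probability distribution over the inputs, an algorithm is a Probably Certifiably Correct (PCC)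 algorithm for this problem and distribution of instances if, with high probability with respect to that distribution, it finds an optimal solution and certifies to have done so, and moreover it never incorrectly certifies a non-optimal solution. Here the certification is the output ''$x_\ast$ is the minimum bisection''. ''With high probability'' means with probability tending to $1$ as the underlying parameters (here $n$) tend to infinity. *)

(* Defs.v *)
From HB Require Import structures.
From mathcomp Require Import all_boot all_order all_algebra.
From mathcomp Require Import all_classical all_reals all_analysis.

Set Implicit Arguments.
Unset Strict Implicit.
Unset Printing Implicit Defensive.

Import Order.TTheory GRing.Theory Num.Theory.
Import numFieldNormedType.Exports.

Local Open Scope classical_set_scope.
Local Open Scope ring_scope.

Definition is_pmf (R : realType) (T : finType) (f : T -> R) : Prop :=
  (forall t, 0 <= f t) /\ \sum_t f t = 1.

(* A randomized algorithm on instances [In n] is a function of the instance and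
   of a seed in [Seed n], drawn independently of the instance; a deterministic
   algorithm is the case where [Seed n] is a singleton. *)
Definition run_prob (R : realType) (In Seed : finType) (mu : In -> R)
    (nu : Seed -> R) (E : In -> Seed -> Prop) : R :=
  \sum_(G : In) \sum_(w : Seed | `[< E G w >]) mu G * nu w.

(* [sizes] is the set of admissible values of the size parameter [n]. *)
Definition whp (R : realType) (sizes : set nat) (In Seed : nat -> finType)
    (mu : forall n, In n -> R) (nu : forall n, Seed n -> R)
    (E : forall n, In n -> Seed n -> Prop) : Prop :=
  run_prob (mu n) (nu n) (E n) @[n --> within sizes \oo] --> (1 : R).

Definition probabilistic_algorithm (R : realType) (sizes : set nat)
    (In Seed Sol : nat -> finType)
    (mu : forall n, In n -> R) (nu : forall n, Seed n -> R)
    (opt : forall n, In n -> Sol n -> Prop)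
    (alg : forall n, In n -> Seed n -> Sol n) : Prop :=
  whp sizes mu nu (fun n G w => opt n G (alg n G w)).

(* The boolean returned along with the solution tells whether the algorithm
   certifies it. *)
Definition PCC_algorithm (R : realType) (sizes : set nat)
    (In Seed Sol : nat -> finType)
    (mu : forall n, In n -> R) (nu : forall n, Seed n -> R)
    (opt : forall n, In n -> Sol n -> Prop)
    (alg : forall n, In n -> Seed n -> Sol n * bool) : Prop :=
  whp sizes mu nu
    (fun n G w => opt n G (alg n G w).1 /\ (alg n G w).2 = true) /\
  (forall n (G : In n) (w : Seed n),
     sizes n -> (alg n G w).2 = true -> opt n G (alg n G w).1).

Definition even_sizes : set nat := [set n | ~~ odd n].

(* Simple graphs on ['I_n], given by their boolean adjacency matrix. *)
Definition sgraph (n : nat) : finType :=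
  {e : 'M[bool]_n | (e^T == e) && [forall i, ~~ e i i]}.

Definition adj (n : nat) (G : sgraph n) (i j : 'I_n) : bool := val G i j.

(* Elements of {-1, 1}^n, encoded by their signs ([true] for -1). *)
Definition signs (n : nat) : finType := {ffun 'I_n -> bool}.

Definition pm1 (R : realType) (n : nat) (x : signs n) : 'cV[R]_n :=
  \col_i (-1) ^+ x i.

Definition equal_clusters (n : nat) (g : signs n) : Prop :=
  forall b : bool, #|[set i | g i == b]%SET| = n./2.

(* Law of G(n, p, q) with clusters given by [g]: the edges are independent
   Bernoulli variables. It is a probability mass function only if p and q lie
   in [0, 1]. *)
Definition sbm_pmf (R : realType) (n : nat) (g : signs n) (p q : R)
    (G : sgraph n) : R :=
  \prod_(i < n) \prod_(j < n | (i < j)%N)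
    let r := if g i == g j then p else q in
    if adj G i j then r else 1 - r.

Definition adjmx (R : realType) (n : nat) (G : sgraph n) : 'M[R]_n :=
  \matrix_(i, j) (adj G i j)%:R.

Definition ones (R : realType) (n : nat) : 'cV[R]_n := const_mx 1.

Definition signed_adjmx (R : realType) (n : nat) (G : sgraph n) : 'M[R]_n :=
  2 *: adjmx R G - (ones R n *m (ones R n)^T - 1%:M).

Definition quad (R : realType) (n : nat) (B : 'M[R]_n) (x : 'cV[R]_n) : R :=
  (x^T *m B *m x) 0 0.

Definition bisection (R : realType) (n : nat) (x : 'cV[R]_n) : Prop :=
  (forall i, x i 0 ^+ 2 = 1) /\ \sum_i x i 0 = 0.

Definition min_bisection (R : realType) (n : nat) (G : sgraph n)
    (x : signs n) : Prop :=
  bisection (pm1 R x) /\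
  forall y : 'cV[R]_n, bisection y ->
    quad (signed_adjmx R G) y <= quad (signed_adjmx R G) (pm1 R x).

(* The real eigenvalues of M with multiplicity, in nondecreasing order; this
   sequence exists for symmetric M, and is unique. *)
Definition eigenvalues (R : realType) (n : nat) (M : 'M[R]_n) : seq R :=
  xget [::] [set s : seq R | sorted <=%R s /\
                             char_poly M = \prod_(a <- s) ('X - a%:P)].

Definition lambda2 (R : realType) (n : nat) (M : 'M[R]_n) : R :=
  (eigenvalues M)`_1.

Definition row_sum_diag (R : realType) (n : nat) (M : 'M[R]_n) : 'M[R]_n :=
  diag_mx (\row_i \sum_j M i j).

Definition certifies (R : realType) (n : nat) (G : sgraph n) (x : signs n) :
    bool :=
  let B := signed_adjmx R G in
  let X := diag_mx (pm1 R x)^T in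
  (((pm1 R x)^T *m ones R n) 0 0 == 0) &&
  (0 < lambda2 (row_sum_diag (X *m B *m X) - B)).

(* Returning [true] stands for the output "x is the minimum bisection", and
   [false] for "Not sure whether x is the minimum bisection". *)
Definition certified_algorithm (R : realType) (Seed : nat -> finType)
    (alg : forall n, sgraph n -> Seed n -> signs n)
    (n : nat) (G : sgraph n) (w : Seed n) : signs n * bool :=
  let x := alg n G w in (x, certifies R G x).

Definition sbm_log (R : realType) (alpha beta : R)
    (g : forall n, signs n) (n : nat) : sgraph n -> R :=
  sbm_pmf (g n) (alpha * (ln n%:R / n%:R)) (beta * (ln n%:R / n%:R)).

(* Main.v *)
Require Import Defs.
From HB Require Import structures.
From mathcomp Require Import all_boot all_order all_algebra.
From mathcomp Require Import all_classical all_reals all_analysis.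
From mathcomp Require Import complex spectral ring lra.

Set Implicit Arguments.
Unset Strict Implicit.
Unset Printing Implicit Defensive.

Import Order.TTheory GRing.Theory Num.Theory.
Import numFieldNormedType.Exports.

Local Open Scope ring_scope.

(** Let [x] be a sign vector with zero sum and [M_x] the certificate matrix. As
    [M_x x = 0] and [y^T M_x y = x^T B x - y^T B y] for every bisection [y], a
    positive second eigenvalue makes [M_x] positive semidefinite, hence [x]
    optimal. Conversely, if [M_g] is positive definite on the orthogonal
    complement of the planted signs [g], then the only minimum bisections are
    [g] and [- g], which have the same certificate matrix. It remains to show
    that with high probability [M_g] is positive definite there, i.e. that
    [min_i d_i], where [d_i] is the number of neighbours of [i] in its cluster
    minus the number of those in the other one, exceeds the largest eigenvalue of
    the centered adjacency matrix.

    Put [L = ln n]. Chernoff's bound for [d_i] has exponent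
    [- (sqrt alpha - sqrt beta)^2 / 2 * L < - L], so by a union bound all the
    [d_i] exceed a constant times [L]. The centered quadratic form is [o(L)] on
    the unit sphere: coordinates with [y_i^2] at most a small constant times
    [L / n] are rounded to a lattice, where a Chernoff bound beats the
    exponential number of lattice points. For an edge with a larger endpoint,
    either the ratio of [|y_i|] and [|y_j|] is large, and then degrees [O(L)]
    suffice, or both endpoints are in a set of [O(n / L)] vertices, all of whose
    subsets [U] span [o(L) #|U|] edges. *)

(** * The spectrum of a symmetric matrix *)

Section SpectralTheorem.
Local Open Scope sesquilinear_scope.

Lemma hermitian_spectral (K : numClosedFieldType) (n : nat) (A : 'M[K]_n) :
  A \is hermsymmx -> exists (P : 'M[K]_n) (sp : 'rV[K]_n),
    [/\ P \is unitarymx, sp \is a realmx & A = P^t* *m diag_mx sp *m P].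
Proof.
move=> hermA; have /orthomx_spectralP eqA := hermitian_normalmx hermA.
have unitP := spectral_unitarymx A.
exists (spectralmx A), (spectral_diag A); split=> //.
  exact: hermitian_spectral_diag_real.
by rewrite -invmx_unitary.
Qed.

Variables (R : realType) (n : nat).
Local Notation C := (complex R).
Local Notation toC := (real_complex R).
Implicit Types (M : 'M[R]_n).

Lemma conj_real_complex (a : R) : (toC a)^* = toC a.
Proof.
by apply/CrealP; apply/complex_realP; exists a.
Qed.

(** The diagonalization takes place over [complex R], where the unitary [P] lives; only the diagonal
    is brought back to [R]. *)
Lemma symmetric_spectral M : M^T = M ->
  exists (P : 'M[C]_n) (d : 'rV[R]_n), P \is unitarymx /\
    map_mx toC M = P^t* *m diag_mx (map_mx toC d) *m P.
Proof.
move=> symM; set A := map_mx toC M.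
have hermA : A \is hermsymmx.
  apply/is_hermitianmxP; rewrite expr0 scale1r; apply/matrixP=> i j.
  by rewrite !mxE conj_real_complex -[in RHS]symM mxE.
have [P [sp [unitP realsp ->]]] := hermitian_spectral hermA.
pose d : 'rV[R]_n := \row_j complex.Re (sp 0 j).
exists P.
exists d.
split; first exact: unitP.
suff -> : map_mx toC d = sp by [].
by apply/matrixP=> i j; rewrite !mxE ord1 RRe_real//; exact: (mxOverP realsp).
Qed.

Lemma char_poly_spectral M (P : 'M[C]_n) (d : 'rV[R]_n) : P \is unitarymx ->
  map_mx toC M = P^t* *m diag_mx (map_mx toC d) *m P ->
  char_poly M = \prod_i ('X - (d 0 i)%:P).
Proof.
move=> unitP eqM; apply: (map_poly_inj toC).
rewrite map_char_poly rmorph_prod /= eqM -invmx_unitary//.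
have uP := unitarymx_unit unitP; set Q := map_mx polyC P.
have uQ : Q \in unitmx by rewrite map_unitmx.
have -> : char_poly (invmx P *m diag_mx (map_mx toC d) *m P) =
          char_poly (diag_mx (map_mx toC d)).
  rewrite /char_poly /char_poly_mx !map_mxM map_invmx -/Q.
  have -> : 'X%:M - invmx Q *m map_mx polyC (diag_mx (map_mx toC d)) *m Q =
     invmx Q *m ('X%:M - map_mx polyC (diag_mx (map_mx toC d))) *m Q.
    by rewrite mulmxBr mulmxBl scalar_mxC -(mulmxA 'X%:M) mulVmx// mulmx1.
  rewrite !det_mulmx det_inv mulrC mulrA divrr ?mul1r//.
rewrite char_poly_trig; last by apply: diag_mx_is_trig.
by apply: eq_bigr => i _; rewrite rmorphB /= map_polyX map_polyC !mxE eqxx mulr1n.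
Qed.

(** The sorted diagonal of a diagonalization is a witness for the choice made in [eigenvalues],
    which therefore does not fall back on its default. *)
Lemma eigenvaluesP M : M^T = M ->
  sorted <=%R (eigenvalues M) /\
  char_poly M = \prod_(a <- eigenvalues M) ('X - a%:P).
Proof.
move=> symM; have [P [d [unitP eqM]]] := symmetric_spectral symM.
suff [s hs] : exists s : seq R, sorted <=%R s /\
    char_poly M = \prod_(a <- s) ('X - a%:P).
  pose S := [set s : seq R | sorted <=%R s /\
    char_poly M = \prod_(a <- s) ('X - a%:P)]%classic.
  exact: (@xgetPex _ [::] S (ex_intro S s hs)).
exists (sort <=%R [seq d 0 i | i <- index_enum 'I_n]); split.
  exact/sort_sorted/le_total.
rewrite (char_poly_spectral unitP eqM).
rewrite [RHS](perm_big [seq d 0 i | i <- index_enum 'I_n]) ?perm_sort//=.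
by rewrite big_map.
Qed.

Lemma perm_eigenvalues M (P : 'M[C]_n) (d : 'rV[R]_n) :
  M^T = M -> P \is unitarymx ->
  map_mx toC M = P^t* *m diag_mx (map_mx toC d) *m P ->
  perm_eq (eigenvalues M) [seq d 0 i | i <- enum 'I_n].
Proof.
move=> symM unitP eqM; apply: prod_XsubC_eq.
rewrite -(eigenvaluesP symM).2 (char_poly_spectral unitP eqM).
by rewrite big_map big_enum.
Qed.

Lemma quad_spectral M (P : 'M[C]_n) (d : 'rV[R]_n) (v : 'rV[C]_n) :
  map_mx toC M = P^t* *m diag_mx (map_mx toC d) *m P ->
  (v *m map_mx toC M *m v^t*) 0 0 =
  \sum_i toC (d 0 i) * `|(v *m P^t*) 0 i| ^+ 2.
Proof.
move=> ->; set w := v *m P^t*.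
have -> : v *m (P^t* *m diag_mx (map_mx toC d) *m P) *m v^t* =
    w *m diag_mx (map_mx toC d) *m w^t*.
  by rewrite /w trmx_mul map_mxM trmxCK !mulmxA.
rewrite mxE; apply: eq_bigr => i _.
by rewrite mul_mx_diag !mxE mulrAC -normCK mulrC.
Qed.

(** The null vector [x] makes 0 an eigenvalue. From the second one on, all eigenvalues are at least
    [lambda2 M > 0], so 0 is the smallest. *)
Lemma psd_of_lambda2_gt0 M (x : 'cV[R]_n) : M^T = M -> x != 0 -> M *m x = 0 ->
  0 < lambda2 M -> forall y : 'cV[R]_n, 0 <= (y^T *m M *m y) 0 0.
Proof.
move=> symM x0 Mx l2 y.
have [P [d [unitP eqM]]] := symmetric_spectral symM.
have [sortM charM] := eigenvaluesP symM.
have permM := perm_eigenvalues symM unitP eqM.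
have d_ge0 i : 0 <= d 0 i.
  have : d 0 i \in eigenvalues M by rewrite (perm_mem permM) map_f// mem_enum.
  have : 0 \in eigenvalues M.
    rewrite -root_prod_XsubC -charM -eigenvalue_root_char.
    apply/eigenvalueP; exists x^T; last by rewrite trmx_eq0.
    by rewrite -[M]symM -trmx_mul Mx trmx0 scale0r.
  move: sortM l2; rewrite /lambda2.
  (* With fewer than two eigenvalues, [lambda2] is the default 0 of [nth], which contradicts
     [l2]. *)
  case: (eigenvalues M) => [|a [|b s]] //=; rewrite ?ltxx//.
  move=> /andP[_ pb] b0.
  have bs c : c \in b :: s -> 0 < c.
    rewrite inE => /predU1P[->//|cs]; apply: (lt_le_trans b0).
    have := pb; rewrite (path_sortedE le_trans) => /andP[/allP h _].
    exact: h.
  rewrite !(in_cons a) => /orP[/eqP a0|/bs]; last by rewrite ltxx.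
  by move=> /orP[/eqP->|/bs/ltW//]; rewrite -a0.
rewrite -ler0c -[X in 0 <= X](_ : (map_mx toC y^T *m map_mx toC M *m (map_mx
  toC y^T)^t*) 0 0 = _).
  rewrite (quad_spectral _ eqM) sumr_ge0// => i _.
  by rewrite mulr_ge0 ?exprn_ge0// ler0c.
have -> : (map_mx toC y^T)^t* = map_mx toC y.
  by apply/matrixP => i j; rewrite !mxE conj_real_complex.
by rewrite -!map_mxM mxE.
Qed.

(** Courant-Fischer by contraposition: eigenvectors for two nonpositive eigenvalues span a plane,
    which contains a nonzero [v] orthogonal to [x], and the form is nonpositive at [v]. As [v] is
    complex, the contradiction comes from its real and imaginary parts. *)
Lemma lambda2_gt0 M (x : 'cV[R]_n) : (1 < n)%N -> M^T = M ->
  (forall y : 'cV[R]_n, y != 0 -> (y^T *m x) 0 0 = 0 ->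
    0 < (y^T *m M *m y) 0 0) ->
  0 < lambda2 M.
Proof.
move=> n1 symM posM.
have [P [d [unitP eqM]]] := symmetric_spectral symM.
have [sortM charM] := eigenvaluesP symM.
have permM := perm_eigenvalues symM unitP eqM.
rewrite ltNge; apply/negP => l2.
have [i [j [ij di dj]]] : exists i j, [/\ i != j, d 0 i <= 0 & d 0 j <= 0].
  have : (1 < count (fun a : R => a <= 0)%R (eigenvalues M))%N.
    have := perm_size permM; rewrite size_map size_enum_ord.
    move: sortM l2; rewrite /lambda2.
    case: (eigenvalues M) => [|a [|b s]] /= + + sn; try by rewrite -sn in n1.
    by move=> /andP[ab _] b0; rewrite b0 (le_trans ab b0).
  rewrite (permP permM) count_map => c1.
  have {c1} : (1 < size [seq k <- enum 'I_n | d 0 k <= 0]%R)%N.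
    by rewrite size_filter.
  set s := seq.filter _ _; have us : uniq s by rewrite filter_uniq ?enum_uniq.
  have sP k : k \in s -> d 0 k <= 0 by rewrite mem_filter => /andP[].
  case: s us sP => [|i [|j s]]//= /andP[+ _] sP _.
  rewrite in_cons negb_or => /andP[ij _].
  by exists i, j; split; rewrite // sP ?in_cons ?eqxx ?orbT.
pose c := P *m map_mx toC x.
(* Coefficients of a nontrivial combination of rows [i] and [j] of [P] that is orthogonal to [x]. *)
have [a [b [ab abc]]] : exists a b : C, (a != 0) || (b != 0) /\
    a * c i 0 + b * c j 0 = 0.
  have [ci|ci] := eqVneq (c i 0) 0.
    by exists 1, 0; rewrite ci oner_eq0 mulr0 mul0r addr0.
  exists (- c j 0), (c i 0); rewrite ci orbT; split => //.
  by rewrite mulNr mulrC addNr.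
pose w : 'rV[C]_n := \row_k (a *+ (k == i) + b *+ (k == j)).
have wi : w 0 i = a by rewrite mxE eqxx (negPf ij) addr0.
have wj : w 0 j = b by rewrite mxE eqxx eq_sym (negPf ij) add0r.
pose v := w *m P.
have vx : v *m map_mx toC x = 0.
  rewrite -mulmxA -/c; apply/matrixP => k l; rewrite !ord1 !mxE.
  rewrite (bigD1 i)// (bigD1 j) /=; last by rewrite eq_sym.
  rewrite big1 ?addr0 => [|k' /andP[/negPf k'i /negPf k'j]].
    by rewrite wi wj.
  by rewrite [w 0 k']mxE k'i k'j addr0 mul0r.
have vP : v *m P^t* = w by rewrite mulmxtVK.
have w0 : w != 0.
  apply/eqP => /matrixP w0; have := w0 0 i; have := w0 0 j.
  rewrite wi wj !mxE => b0 a0.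
  by move: ab; rewrite a0 b0 eqxx.
have v0 : v != 0 by apply: contra w0 => /eqP v0; rewrite -vP v0 mul0mx.
have quad_le0 : (v *m map_mx toC M *m v^t*) 0 0 <= 0.
  have dC k : d 0 k <= 0 -> toC (d 0 k) <= 0 by rewrite lecE /= eqxx.
  rewrite (quad_spectral _ eqM) vP sumr_le0// => k _; rewrite [w 0 k]mxE.
  have [ki|ki] := eqVneq k i.
    by rewrite mulr_le0_ge0 ?exprn_ge0 ?dC ?ki.
  have [kj|kj] := eqVneq k j.
    by rewrite mulr_le0_ge0 ?exprn_ge0 ?dC ?kj.
  by rewrite addr0 normr0 expr0n mulr0.
clearbody v.
pose yr : 'cV[R]_n := \col_k complex.Re (v 0 k).
pose yi : 'cV[R]_n := \col_k complex.Im (v 0 k).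
pose r := map_mx toC yr^T; pose t := map_mx toC yi^T.
pose I : C := complex.Complex 0 1.
have I2 : I * I = -1 by rewrite -expr2 sqr_i.
have IC : I^* = - I by apply/eqP; rewrite eq_complex /= oppr0 !eqxx.
have vE : v = r + I *: t.
  by apply/rowP => k; rewrite !mxE {1}[v 0 k]complexE.
have vCE : v^t* = r^T - I *: t^T.
  apply/colP => k; rewrite vE !mxE rmorphD rmorphM /= IC.
  by rewrite !conj_real_complex mulNr.
have rE : r^T = map_mx toC yr by rewrite /r -map_trmx trmxK.
have tE : t^T = map_mx toC yi by rewrite /t -map_trmx trmxK.
(* Since [x] is real, orthogonality passes to both parts of [v]. *)
have [yrx yix] : (yr^T *m x) 0 0 = 0 /\ (yi^T *m x) 0 0 = 0.
  move: vx; rewrite vE mulmxDl -scalemxAl -!map_mxM => /matrixP/(_ 0 0).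
  rewrite !mxE => /eqP; rewrite eq_complex /=.
  by move=> /andP[/eqP h1 /eqP h2]; split; lra.
(* The two cross terms cancel because [M] is symmetric. *)
have quadE : (v *m map_mx toC M *m v^t*) 0 0 =
   toC ((yr^T *m M *m yr) 0 0 + (yi^T *m M *m yi) 0 0).
  rewrite vCE vE !(mulmxDl, mulmxDr, mulmxN) -!scalemxAl -!scalemxAr scalerA I2.
  rewrite scaleN1r opprK rE tE -!map_mxM.
  have -> : yi^T *m M *m yr = yr^T *m M *m yi.
    have trmx11 (A : 'M[R]_1) : A^T = A.
      by apply/matrixP => k l; rewrite !ord1 mxE.
    by rewrite -[LHS]trmx11 !trmx_mul trmxK symM mulmxA.
  by rewrite addrA addrK [LHS]mxE rmorphD; congr (_ + _); exact: mxE.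
have posM0 (y : 'cV[R]_n) : (y^T *m x) 0 0 = 0 -> 0 <= (y^T *m M *m y) 0 0.
  move=> yx; have [->|y0] := eqVneq y 0; last exact/ltW/posM.
  by rewrite mulmx0 mxE.
move: quad_le0; rewrite quadE lecE /= eqxx /= leNgt => /negP; apply.
have [yr0|yr0] := eqVneq yr 0; last by rewrite ltr_wpDr ?posM ?posM0.
have [yi0|yi0] := eqVneq yi 0; last by rewrite ltr_wpDl ?posM ?posM0.
move: v0; rewrite vE /r /t yr0 yi0 trmx0 !map_mx0 scaler0 addr0 eqxx.
by [].
Qed.
End SpectralTheorem.

(** * Exponential bounds for the stochastic block model *)

Section StochasticBlockModel.
Variables (R : realType) (n : nat).
Implicit Types (G : sgraph n) (f c : 'I_n -> 'I_n -> R).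

Lemma adj_sym G i j : adj G i j = adj G j i.
Proof.
rewrite /adj; have /andP[/eqP symG _] := valP G.
by rewrite -[in LHS]symG mxE.
Qed.

Lemma adj_irr G i : adj G i i = false.
Proof. by rewrite /adj; have /andP[_ /forallP/(_ i)/negPf] := valP G. Qed.

(** Graphs are encoded as boolean functions that vanish off the pairs [i < j], the index set
    produced by distributing a product over sums. *)
Definition edge_fun (G : sgraph n) : {ffun 'I_n * 'I_n -> bool} :=
  [ffun e : 'I_n * 'I_n => (e.1 < e.2)%N && adj G e.1 e.2].

Definition edge_mx (f : {ffun 'I_n * 'I_n -> bool}) : 'M[bool]_n :=
  \matrix_(i, j) (if (i < j)%N then f (i, j) else (j < i)%N && f (j, i)).

Lemma edge_mx_subproof (f : {ffun 'I_n * 'I_n -> bool}) :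
  ((edge_mx f)^T == edge_mx f) && [forall i, ~~ edge_mx f i i].
Proof.
apply/andP; split; last by apply/forallP => i; rewrite mxE ltnn.
by apply/eqP/matrixP => i j; rewrite !mxE; case: ltngtP.
Qed.

Definition graph_of_edges (f : {ffun 'I_n * 'I_n -> bool}) : sgraph n :=
  exist _ (edge_mx f) (edge_mx_subproof f).

(** Expanding the right-hand product chooses a boolean for each pair [i < j], that is, a graph. This
    is how the independence of the edges enters. *)
Lemma sum_sgraph_prod (F : 'I_n -> 'I_n -> bool -> R) :
  \sum_(G : sgraph n) \prod_(i < n) \prod_(j < n | (i < j)%N) F i j (adj G i j)
  = \prod_(i < n) \prod_(j < n | (i < j)%N) (F i j true + F i j false).
Proof.
rewrite pair_big_dep /=.
transitivity (\prod_(e : 'I_n * 'I_n | (e.1 < e.2)%N) \sum_(b : bool) F e.1 e.2 b);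
  last by apply: eq_bigr => e _; rewrite big_bool.
rewrite (big_distr_big_dep false) (reindex_onto edge_fun graph_of_edges) /=;
  last first.
  move=> f /pfamilyP[fsupp _]; apply/ffunP => -[i j]; rewrite ffunE /adj /= mxE.
  case: ifP => //= ij; apply/esym/negbTE/negP => fij.
  have /(fintype.subsetP fsupp) : (i, j) \in false.-support f by rewrite inE fij.
  by rewrite unfold_in /= ij.
apply: eq_big => [G|G _].
  apply/esym/andP; split.
    apply/pfamilyP; split=> //; apply/fintype.subsetP => e.
    by rewrite inE ffunE => eG; rewrite unfold_in; case: (_ < _)%N eG.
  apply/eqP/val_inj/matrixP => i j; rewrite mxE !ffunE /=.
  case: ltngtP => //= ij; first by rewrite [in LHS]adj_sym.
  by rewrite -/(adj G i j) (val_inj ij) adj_irr.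
rewrite pair_big_dep /=; apply: eq_bigr => -[i j] /= ij.
by rewrite ffunE /= ij.
Qed.

Lemma sum_offdiag f : (forall i j, f i j = f j i) ->
  \sum_i \sum_(j | j != i) f i j = 2 * \sum_(i < n) \sum_(j < n | (i < j)%N) f i j.
Proof.
move=> symf.
have -> : \sum_i \sum_(j | j != i) f i j =
    \sum_(i < n) \sum_(j < n | (i < j)%N) f i j + \sum_(i < n) \sum_(j < n | (j
      < i)%N) f i j.
  rewrite -big_split/=; apply: eq_bigr => i _.
  rewrite (bigID (fun j : 'I_n => (i < j)%N))/=; congr (_ + _); apply: eq_bigl => j.
    by rewrite -val_eqE /= neq_ltn orbC; case: (ltngtP i j).
  by rewrite -val_eqE /=; case: (ltngtP i j).
rewrite [X in _ + X](exchange_big_dep predT)//= mulr_natl mulr2n; congr (_ + _).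
by apply: eq_bigr => i _; apply: eq_bigr => j _.
Qed.

Variables (g : signs n) (p q : R).
Hypotheses (p01 : 0 <= p <= 1) (q01 : 0 <= q <= 1).

(** On the diagonal the value is [p] and not 0, hence the [*+ (i != j)] in the centered forms
    below. *)
Definition edge_prob (i j : 'I_n) : R := if g i == g j then p else q.

Lemma edge_prob01 i j : 0 <= edge_prob i j <= 1.
Proof. by rewrite /edge_prob; case: ifP. Qed.

Lemma edge_prob_sym i j : edge_prob i j = edge_prob j i.
Proof. by rewrite /edge_prob eq_sym. Qed.

Lemma sbm_pmf_ge0 G : 0 <= sbm_pmf g p q G.
Proof.
apply: prodr_ge0 => i _; apply: prodr_ge0 => j _.
have /andP[r0 r1] := edge_prob01 i j; rewrite -/(edge_prob i j).
by case: (adj G i j) => //=; rewrite subr_ge0.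
Qed.

Lemma sbm_pmf_sum1 : \sum_G sbm_pmf g p q G = 1.
Proof.
rewrite (sum_sgraph_prod (fun i j b => if b then edge_prob i j else 1 -
  edge_prob i j)).
by rewrite big1// => i _; rewrite big1// => j _; rewrite addrC subrK.
Qed.

Definition sbm_prob (E : pred (sgraph n)) : R := \sum_(G | E G) sbm_pmf g p q G.

(** Chernoff's bound for a weighted count of edges, the exponential parameter being absorbed in [c].
    Sums over ordered pairs see each edge twice, hence the halves. *)
Lemma sbm_chernoff c (t : R) : (forall i j, c i j = c j i) ->
  sbm_prob (fun G => t <= (\sum_i \sum_j c i j * (adj G i j)%:R) / 2) <=
  expR (- t + (\sum_i \sum_(j | j != i) edge_prob i j * (expR (c i j) - 1)) / 2).
Proof.
move=> symc.
have halfE G : (\sum_i \sum_j c i j * (adj G i j)%:R) / 2 =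
    \sum_(i < n) \sum_(j < n | (i < j)%N) c i j * (adj G i j)%:R.
  have -> : \sum_i \sum_j c i j * (adj G i j)%:R =
      \sum_i \sum_(j | j != i) c i j * (adj G i j)%:R.
    by apply: eq_bigr => i _; rewrite (bigD1 i)//= adj_irr mulr0 add0r.
  rewrite sum_offdiag ?[2 * _]mulrC ?mulfK// => i j.
  by rewrite symc adj_sym.
pose S G := \sum_(i < n) \sum_(j < n | (i < j)%N) c i j * (adj G i j)%:R.
(* Markov's inequality for [expR (S G - t)]. *)
apply: (@le_trans _ _ (\sum_G sbm_pmf g p q G * expR (S G - t))).
  rewrite /sbm_prob big_mkcond ler_sum// => G _; rewrite halfE -/(S G).
  case: ifP => [tS|_]; last by rewrite mulr_ge0 ?sbm_pmf_ge0 ?expR_ge0.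
  by rewrite ler_peMr ?sbm_pmf_ge0// -expR0 ler_expR subr_ge0.
have -> : \sum_G sbm_pmf g p q G * expR (S G - t) = expR (- t) *
    \sum_G \prod_(i < n) \prod_(j < n | (i < j)%N)
      ((if adj G i j then edge_prob i j else 1 - edge_prob i j) *
       expR (c i j * (adj G i j)%:R)).
  rewrite mulr_sumr; apply: eq_bigr => G _.
  rewrite addrC expRD mulrCA; congr (_ * _).
  rewrite /S expR_sum -big_split/=; apply: eq_bigr => i _.
  by rewrite expR_sum -big_split.
rewrite (sum_sgraph_prod (fun i j b => (if b then edge_prob i j else 1 -
  edge_prob i j) *
  expR (c i j * b%:R))).
rewrite expRD ler_wpM2l ?expR_ge0//.
rewrite sum_offdiag; last by move=> i j; rewrite edge_prob_sym symc.
rewrite [2 * _]mulrC mulfK// expR_sum ler_prod// => i _.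
rewrite prodr_ge0/=; last first.
  move=> j _; have /andP[r0 r1] := edge_prob01 i j.
  by rewrite addr_ge0// mulr_ge0 ?expR_ge0// subr_ge0.
rewrite expR_sum ler_prod// => j _; have /andP[r0 r1] := edge_prob01 i j.
rewrite addr_ge0 ?mulr_ge0 ?expR_ge0 ?subr_ge0//=.
(* With [r] the edge probability, the factor of a pair is [1 + r * (expR c - 1)], at most
   [expR (r * (expR c - 1))]. *)
rewrite mulr1 mulr0 expR0 mulr1; apply: le_trans (expR_ge1Dx _).
by rewrite mulrBr mulr1; lra.
Qed.


Lemma sbm_prob_le (E F : pred (sgraph n)) : (forall G, E G -> F G) ->
  sbm_prob E <= sbm_prob F.
Proof.
move=> EF; rewrite /sbm_prob big_mkcond [leRHS]big_mkcond ler_sum// => G _.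
by have := EF G; case: (E G) => [->//|_]; case: ifP => // _; apply: sbm_pmf_ge0.
Qed.

Lemma sbm_probU (E F : pred (sgraph n)) :
  sbm_prob (fun G => E G || F G) <= sbm_prob E + sbm_prob F.
Proof.
rewrite /sbm_prob big_mkcond [X in _ <= X + _]big_mkcond [X in _ <= _ +
  X]big_mkcond.
rewrite -big_split ler_sum// => G _ /=; have G0 := sbm_pmf_ge0 G.
by case: (E G) => /=; case: (F G) => /=; rewrite ?addr0 ?add0r// lerDr.
Qed.

Lemma sbm_prob_union (I : finType) (P : pred I) (E : I -> pred (sgraph n)) :
  sbm_prob (fun G => [exists x, P x && E x G]) <= \sum_(x | P x) sbm_prob (E x).
Proof.
rewrite /sbm_prob (exchange_big_dep predT)//= big_mkcond ler_sum// => G _.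
case: ifP => [/existsP[x /andP[Px Ex]]|_]; last first.
  by rewrite sumr_ge0// => x _; apply: sbm_pmf_ge0.
rewrite (bigD1 x) ?Px//= lerDl sumr_ge0// => y _; exact: sbm_pmf_ge0.
Qed.

(** Chernoff's bound with weights supported on the row and the column of [i0]. *)
Lemma star_chernoff (i0 : 'I_n) (w : 'I_n -> R) (t : R) :
  sbm_prob (fun G => t <= \sum_j w j * (adj G i0 j)%:R) <=
  expR (- t + \sum_(j | j != i0) edge_prob i0 j * (expR (w j) - 1)).
Proof.
pose c i j := if i == i0 then w j else if j == i0 then w i else 0.
have symc i j : c i j = c j i.
  by rewrite /c; case: eqVneq => [->|ii0]; case: eqVneq => // ->.
have star f : (forall i j, f i j = f j i) ->
    (forall i j, i != i0 -> j != i0 -> f i j = 0) ->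
    \sum_i \sum_(j | j != i) f i j = 2 * \sum_(j | j != i0) f i0 j.
  move=> symf f0; rewrite (bigD1 i0)//= mulr_natl mulr2n; congr (_ + _).
  apply: eq_bigr => i ii0; rewrite (bigD1 i0) /=; last by rewrite eq_sym.
  rewrite big1; first by rewrite addr0; exact: symf.
  by move=> j /andP[_]; exact: f0.
have two0 : 2 != 0 :> R by rewrite pnatr_eq0.
have := sbm_chernoff t symc.
rewrite [X in _ <= expR (_ + X / _)]star; first last.
- by move=> i j /negPf ii0 /negPf ji0; rewrite /c ii0 ji0 expR0 subrr mulr0.
- by move=> i j; rewrite edge_prob_sym symc.
rewrite [2 * _]mulrC (mulfK two0).
have -> : \sum_(j | j != i0) edge_prob i0 j * (expR (c i0 j) - 1) =
    \sum_(j | j != i0) edge_prob i0 j * (expR (w j) - 1).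
  by apply: eq_bigr => j _; rewrite /c eqxx.
apply: le_trans; apply: sbm_prob_le => G; suff -> :
  (\sum_i \sum_j c i j * (adj G i j)%:R) / 2 = \sum_j w j * (adj G i0 j)%:R by [].
have -> : \sum_i \sum_j c i j * (adj G i j)%:R =
    \sum_i \sum_(j | j != i) c i j * (adj G i j)%:R.
  by apply: eq_bigr => i _; rewrite (bigD1 i)//= adj_irr mulr0 add0r.
rewrite star; first last.
- by move=> i j /negPf ii0 /negPf ji0; rewrite /c ii0 ji0 mul0r.
- by move=> i j; rewrite symc adj_sym.
rewrite [2 * _]mulrC (mulfK two0) [RHS](bigD1 i0)//= adj_irr mulr0 add0r.
by apply: eq_bigr => j _; rewrite /c eqxx.
Qed.

(** * Tails of degrees, induced edge counts and centered quadratic forms *)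

Hypothesis qp : q <= p.

Lemma edge_prob_le i j : edge_prob i j <= p.
Proof. by rewrite /edge_prob; case: ifP. Qed.

Lemma degree_tail (i : 'I_n) (v : R) :
  sbm_prob (fun G => v <= \sum_j (adj G i j)%:R) <=
  expR (- v + n%:R * p * expR 1).
Proof.
have := star_chernoff i (fun=> 1) v.
under [X in sbm_prob X]eq_fun do under eq_bigr do rewrite mul1r.
move=> /le_trans; apply; rewrite ler_expR lerD2l.
apply: (@le_trans _ _ (\sum_(j < n) p * expR 1)); last first.
  by rewrite sumr_const card_ord -[leLHS]mulr_natl mulrA.
rewrite big_mkcond ler_sum// => j _; have /andP[p0 _] := p01.
case: ifP => _; last by rewrite mulr_ge0 ?expR_ge0.
have /andP[r0 _] := edge_prob01 i j.
apply: ler_pM; rewrite ?edge_prob_le ?subr_ge0 ?gerBl//.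
by rewrite -expR0 ler_expR.
Qed.

(** Weight [lam] goes on the pairs inside [U]. The parameter stays free, since a large one is needed
    to beat the number of sets [U]. *)
Lemma induced_edges_tail (U : {set 'I_n}) (lam v : R) : 0 <= lam ->
  sbm_prob (fun G => v <= \sum_(i in U) \sum_(j in U) (adj G i j)%:R) <=
  expR (- (lam * v / 2) + p * #|U|%:R ^+ 2 * expR lam / 2).
Proof.
move=> lam0; pose c i j := lam *+ ((i \in U) && (j \in U)).
have symc i j : c i j = c j i by rewrite /c andbC.
apply: le_trans (le_trans (sbm_chernoff (lam * v / 2) symc) _).
  apply: sbm_prob_le => G vG; rewrite ler_pM2r ?invr_gt0//.
  apply: (le_trans (ler_wpM2l lam0 vG)).
  rewrite big_mkcond mulr_sumr ler_sum// => i _.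
  rewrite (big_mkcond (mem U)) /=; case: (boolP (i \in U)) => iU; last first.
    by rewrite mulr0 sumr_ge0// => j _; rewrite mulr_ge0// /c mulrn_wge0.
  rewrite mulr_sumr ler_sum// => j _; rewrite /c iU /=.
  by case: (j \in U); rewrite ?mulr1n// mulr0 mul0r.
rewrite ler_expR lerD2l ler_pM2r ?invr_gt0//.
have -> : p * #|U|%:R ^+ 2 * expR lam =
    \sum_(i in U) \sum_(j in U) p * expR lam.
  by rewrite !sumr_const; ring.
rewrite [leRHS]big_mkcond ler_sum// => i _; have /andP[p0 _] := p01.
have P0 : 0 <= p * expR lam by rewrite mulr_ge0 ?expR_ge0.
rewrite [leLHS]big_mkcond; case: (boolP (i \in U)) => iU; last first.
  by rewrite big1// => j _; rewrite /c (negPf iU) expR0 subrr mulr0 if_same.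
rewrite [leRHS]big_mkcond ler_sum// => j _; have /andP[r0 _] := edge_prob01 i j.
rewrite /c iU /=; case: (j \in U); last by rewrite mulr0n expR0 subrr mulr0 if_same.
case: ifP => // _; apply: ler_pM;
  rewrite ?edge_prob_le ?subr_ge0 ?gerBl ?expR_ge0//.
by rewrite -expR0 ler_expR mulr1n.
Qed.

(** From [expR c <= (1 - c)^-1] and [(1 - c) * (1 + c + 2 * c ^+ 2) = 1 + c ^+ 2 * (1 - 2 * c)]. *)
Lemma expR_le_quadratic (c : R) : c <= 2^-1 -> expR c <= 1 + c + 2 * c ^+ 2.
Proof.
move=> c2; have h : 1 - c <= expR (- c) by exact: expR_ge1Dx.
have c1 : 0 < 1 - c by lra.
rewrite -[c in expR c]opprK expRN.
apply: (@le_trans _ _ (1 - c)^-1); first by rewrite lef_pV2 ?posrE ?expR_gt0.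
rewrite -[leLHS]mul1r ler_pdivrMr//.
have : 0 <= c ^+ 2 * (1 - 2 * c) by rewrite mulr_ge0 ?sqr_ge0//; lra.
by lra.
Qed.

(** Centering cancels the first-order part of [expR c - 1]; [expR_le_quadratic] leaves a
    second-order part whose sum factors as [(\sum_i f i ^+ 2) ^+ 2]. *)
Lemma centered_form_tail (f : 'I_n -> R) (theta v : R) :
  (forall i j, `|theta * (f i * f j)| <= 2^-1) -> 0 <= theta ->
  sbm_prob (fun G => v <= \sum_i \sum_j
     ((adj G i j)%:R - edge_prob i j *+ (i != j)) * (f i * f j)) <=
  expR (- (theta * v / 2) + p * theta ^+ 2 * (\sum_i f i ^+ 2) ^+ 2).
Proof.
move=> small th0; pose c i j := theta * (f i * f j).
have symc i j : c i j = c j i by rewrite /c [f i * _]mulrC.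
pose S := \sum_i \sum_(j | j != i) edge_prob i j * c i j.
apply: le_trans (le_trans (sbm_chernoff (theta * v / 2 + S / 2) symc) _).
  apply: sbm_prob_le => G vG; rewrite -mulrDl ler_pM2r ?invr_gt0//.
  rewrite -lerBrDr; apply: (le_trans (ler_wpM2l th0 vG)).
  rewrite le_eqVlt; apply/orP; left; apply/eqP.
  rewrite mulr_sumr /S -sumrB; apply: eq_bigr => i _.
  rewrite mulr_sumr [X in _ - X]big_mkcond -sumrB; apply: eq_bigr => j _.
  by rewrite /c [j == i]eq_sym; case: eqVneq => _ /=; rewrite ?mulr1n ?mulr0n; ring.
rewrite ler_expR opprD -addrA lerD2l addrC -mulrBl.
rewrite ler_pdivrMr// /S -sumrB.
have -> : p * theta ^+ 2 * (\sum_i f i ^+ 2) ^+ 2 * 2 =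
    \sum_i \sum_j p * (2 * c i j ^+ 2).
  rewrite [(\sum_i _) ^+ 2]expr2 big_distrlr /= mulr_sumr mulr_suml.
  apply: eq_bigr => i _; rewrite mulr_sumr mulr_suml; apply: eq_bigr => j _.
  by rewrite /c; ring.
apply: ler_sum => i _; rewrite -sumrB big_mkcond ler_sum// => j _.
have /andP[p0 _] := p01; have /andP[r0 _] := edge_prob01 i j.
have c0 : 0 <= 2 * c i j ^+ 2 by rewrite mulr_ge0 ?sqr_ge0.
case: ifP => _; last by rewrite mulr_ge0.
rewrite -mulrBr; have c2 : c i j <= 2^-1 by apply: le_trans (small i j);
  apply: ler_norm.
apply: (@le_trans _ _ (edge_prob i j * (2 * c i j ^+ 2))).
  by rewrite ler_wpM2l//; have := expR_le_quadratic c2; lra.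
by rewrite ler_wpM2r ?edge_prob_le.
Qed.
End StochasticBlockModel.

(** * A deterministic bound on the centered quadratic form *)

Section Deterministic.
Variables (R : realType) (n : nat).
Implicit Types (a b r : 'I_n -> 'I_n -> R) (w y u m : 'I_n -> R).

Lemma sqr_normr (x : R) : `|x| ^+ 2 = x ^+ 2.
Proof. exact/real_normK/num_real. Qed.

(* Layer cake: removing the smallest positive value from all of the support
   lowers the left-hand side by at most [c] times what it removes on the right. *)
Lemma sum_min_le a w (c : R) : (forall i j, 0 <= a i j) -> (forall i, 0 <= w i) ->
  (forall U : {set 'I_n}, {in U, forall i, 0 < w i} ->
    \sum_(i in U) \sum_(j in U) a i j <= c * #|U|%:R) ->
  \sum_i \sum_j a i j * Num.min (w i) (w j) <= c * \sum_i w i.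
Proof.
move=> a0; move: {2}#|_| (leqnn #|[set i | 0 < w i]|) => s.
elim: s w => [|s IHs] w ws w0 aU.
  have wz i : w i = 0.
    apply/eqP; rewrite eq_le w0 andbT leNgt; apply/negP => wi.
    by move: ws; rewrite leqn0 cards_eq0 => /eqP/setP/(_ i); rewrite !inE wi.
  rewrite !big1 ?mulr0// => i _; first by rewrite big1// => j _;
    rewrite !wz minxx mulr0.
pose U := [set i | 0 < w i].
have [U0|[i0 i0U]] := set_0Vmem U; first by apply: IHs => //; rewrite -/U U0 cards0.
have [i1 /= i1m min1] := arg_minP w i0U; have i1U : i1 \in U := i1m.
have UE i : (i \in U) = (0 < w i) by rewrite inE.
have wU i : i \notin U -> w i = 0.
  by move=> iU; apply/eqP; rewrite eq_le w0 andbT leNgt -UE.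
pose t := w i1; have t0 : 0 < t by rewrite -UE.
pose w' i := w i - t *+ (i \in U).
have w'0 i : 0 <= w' i.
  rewrite /w'; have [iU|iU] := boolP (i \in U); last by rewrite subr0.
  by rewrite subr_ge0 min1.
have w'U i : 0 < w' i -> 0 < w i.
  by move=> wi; apply: (lt_le_trans wi); rewrite gerBl mulrn_wge0// ltW.
(* Inside [U] both arguments drop by [t]; outside, the minimum is 0 before and after. *)
have minE i j : Num.min (w i) (w j) =
    Num.min (w' i) (w' j) + t *+ ((i \in U) && (j \in U)).
  rewrite /w'; have [iU|iU] := boolP (i \in U);
    have [jU|jU] := boolP (j \in U) => /=.
  - by rewrite addr_minl !mulr1n !subrK.
  - by rewrite (wU _ jU) subr0 addr0 !min_r// ?w0// subr_ge0 min1.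
  - by rewrite (wU _ iU) subr0 addr0 !min_l// ?w0// subr_ge0 min1.
  - by rewrite !subr0 addr0.
have -> : \sum_i \sum_j a i j * Num.min (w i) (w j) =
    \sum_i \sum_j a i j * Num.min (w' i) (w' j) +
    t * \sum_(i in U) \sum_(j in U) a i j.
  rewrite [X in _ + _ * X]big_mkcond mulr_sumr -big_split/=; apply: eq_bigr => i _.
  have [iU|iU] := boolP (i \in U); last first.
    rewrite mulr0 addr0; apply: eq_bigr => j _.
    by rewrite minE (negPf iU) addr0.
  rewrite [X in _ + _ * X](big_mkcond (mem U)) mulr_sumr -big_split/=;
    apply: eq_bigr => j _.
  rewrite minE iU /= mulrDr; congr (_ + _).
  by case: (j \in U); rewrite ?mulr0// mulrC.
have -> : \sum_i w i = \sum_i w' i + t * #|U|%:R.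
  rewrite -sum1_card natr_sum mulr_sumr [X in _ + X]big_mkcond -big_split/=.
  by apply: eq_bigr => i _; rewrite /w'; case: (i \in U);
    rewrite ?mulr1 ?subrK// subr0 addr0.
rewrite mulrDr lerD//; last first.
  by rewrite (mulrCA c) ler_wpM2l ?(ltW t0)//; apply: aU => i; rewrite UE.
apply: IHs => // [|V VU]; last by apply: aU => i /VU/w'U.
(* The minimizer [i1] leaves the support, so the induction on its cardinal applies. *)
rewrite -ltnS; apply: leq_trans ws; apply: proper_card.
apply/properP; split; first by apply/fintype.subsetP => i; rewrite !inE => /w'U.
by exists i1; rewrite // inE /w' i1U subrr ltxx.
Qed.

(** Each term is split by the inequality of arithmetic and geometric means with weight [s]; row sums
    of [|b|] bound both halves. The free [s] balances [f] and [g] of different sizes. *)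
Lemma schur_test b (f g : 'I_n -> R) (D s : R) : 0 < s ->
  (forall i j, b i j = b j i) -> (forall i, \sum_j `|b i j| <= D) ->
  \sum_i \sum_j b i j * (f i * g j) <=
  D * (s * \sum_i f i ^+ 2 + s^-1 * \sum_i g i ^+ 2) / 2.
Proof.
move=> s0 symb bD.
have term i j : b i j * (f i * g j) <=
    (s * (`|b i j| * f i ^+ 2) + s^-1 * (`|b i j| * g j ^+ 2)) / 2.
  have -> : (s * (`|b i j| * f i ^+ 2) + s^-1 * (`|b i j| * g j ^+ 2)) / 2 =
    `|b i j| * ((s * f i ^+ 2 + s^-1 * g j ^+ 2) / 2) by ring.
  apply: (le_trans (ler_norm _)); rewrite normrM ler_wpM2l//.
  have := sqr_ge0 (s * `|f i| - `|g j|);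
    rewrite normrM -(sqr_normr (f i)) -(sqr_normr (g j)) => h.
  have : 0 <= s^-1 * (s * `|f i| - `|g j|) ^+ 2 by rewrite mulr_ge0// invr_ge0 ltW.
  have -> : s^-1 * (s * `|f i| - `|g j|) ^+ 2 = s * `|f i| ^+ 2 - 2 * (`|f i| *
    `|g j|) + s^-1 * `|g j| ^+ 2.
    by field; rewrite gt_eqF.
  lra.
apply: (le_trans (ler_sum _ (fun i _ => ler_sum _ (fun j _ => term i j)))).
have -> : \sum_i \sum_j (s * (`|b i j| * f i ^+ 2) + s^-1 * (`|b i j| * g j ^+
  2)) / 2
  = (s * \sum_i (\sum_j `|b i j|) * f i ^+ 2 + s^-1 * \sum_j (\sum_i `|b j i|)
    * g j ^+ 2) / 2.
  rewrite -[RHS]mulrC mulrDr !mulr_sumr.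
  have e i : \sum_j (s * (`|b i j| * f i ^+ 2) + s^-1 * (`|b i j| * g j ^+ 2)) / 2 =
   2^-1 * (s * ((\sum_j `|b i j|) * f i ^+ 2)) + \sum_j 2^-1 * (s^-1 * (`|b j
     i| * g j ^+ 2)).
    rewrite mulr_suml !mulr_sumr -big_split/=; apply: eq_bigr => j _.
    by rewrite (symb j i); ring.
  rewrite (eq_bigr _ (fun i _ => e i)) big_split/=; congr (_ + _).
  rewrite exchange_big/=; apply: eq_bigr => j _.
  by rewrite mulr_suml !mulr_sumr.
rewrite ler_pM2r ?invr_gt0// mulrDr ?ltr0n// lerD//.
  rewrite mulrCA ler_wpM2l ?(ltW s0)// mulr_sumr ler_sum// => i _.
  by rewrite ler_wpM2r ?sqr_ge0.
rewrite mulrCA ler_wpM2l ?invr_ge0 ?(ltW s0)// mulr_sumr ler_sum// => i _.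
by rewrite ler_wpM2r ?sqr_ge0.
Qed.

Definition sq_above (lo t : R) : R := if lo <= t ^+ 2 then t ^+ 2 else 0.

(** If one of [|x|], [|z|] is at most [eta] times the other, the first term suffices. Otherwise both
    squares exceed [eta ^+ 2 * tau], and the product is at most the smaller square over [eta]. *)
Lemma prod_le_balanced (x z eta tau : R) : 0 < eta <= 1 -> 0 <= tau ->
  (tau < x ^+ 2) || (tau < z ^+ 2) ->
  `|x| * `|z| <= eta * (x ^+ 2 + z ^+ 2) +
    eta^-1 * Num.min (sq_above (eta ^+ 2 * tau) x) (sq_above (eta ^+ 2 * tau) z).
Proof.
move=> /andP[e0 e1] t0 big; set w := sq_above _.
rewrite -(sqr_normr x) -(sqr_normr z).
have w0 t : 0 <= w t by rewrite /w /sq_above; case: ifP => // _; rewrite sqr_ge0.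
have m0 : 0 <= eta^-1 * Num.min (w x) (w z).
  by rewrite mulr_ge0 ?invr_ge0 ?(ltW e0)// le_min !w0.
have [xz|zx] := leP `|x| (eta * `|z|).
  have : `|x| * `|z| <= eta * `|z| * `|z| by rewrite ler_wpM2r.
  have : 0 <= eta * `|x| ^+ 2 by rewrite mulr_ge0 ?sqr_ge0 ?(ltW e0).
  by lra.
have [xz|xz] := leP `|z| (eta * `|x|).
  have : `|x| * `|z| <= `|x| * (eta * `|x|) by rewrite ler_wpM2l.
  have : 0 <= eta * `|z| ^+ 2 by rewrite mulr_ge0 ?sqr_ge0 ?(ltW e0).
  by lra.
have sx : eta ^+ 2 * z ^+ 2 <= x ^+ 2.
  by rewrite -exprMn -(sqr_normr x) -(sqr_normr (_ * _)) ler_sqr ?nnegrE//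
    normrM (gtr0_norm e0) ltW.
have sz : eta ^+ 2 * x ^+ 2 <= z ^+ 2.
  by rewrite -exprMn -(sqr_normr z) -(sqr_normr (_ * _)) ler_sqr ?nnegrE//
    normrM (gtr0_norm e0) ltW.
have e2 : eta ^+ 2 <= 1 by rewrite expr_le1// ltW.
have e2t : eta ^+ 2 * tau <= tau by rewrite ler_piMl.
have [hx hz] : eta ^+ 2 * tau <= x ^+ 2 /\ eta ^+ 2 * tau <= z ^+ 2.
  case/orP: big => h; split.
  - exact/(le_trans e2t)/ltW.
  - by apply: le_trans sz; rewrite ler_wpM2l ?sqr_ge0// ltW.
  - by apply: le_trans sx; rewrite ler_wpM2l ?sqr_ge0// ltW.
  - exact/(le_trans e2t)/ltW.
rewrite /w /sq_above hx hz -(sqr_normr x) -(sqr_normr z).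
apply: ler_wpDl; first by rewrite mulr_ge0 ?addr_ge0 ?sqr_ge0 ?(ltW e0).
rewrite minEle; case: ifP => _; rewrite -ler_pdivrMl ?invr_gt0// invrK.
  by rewrite mulrCA expr2 ler_wpM2l// ltW.
by rewrite mulrA expr2 ler_wpM2r// ltW.
Qed.

(** Integers as sign and absolute value: once the latter is bounded, lattice points form a finite
    type. *)
Definition signed_nat (c : bool * nat) : R := (-1) ^+ c.1 * c.2%:R.

(** Rounding towards 0, so that bounds on coordinates and on the norm survive it. *)
Definition trunc0 (t : R) : bool * nat := (t < 0, Num.truncn `|t|).

Lemma trunc0_abs t : `|signed_nat (trunc0 t)| <= `|t|.
Proof. by rewrite normrM normr_sign mul1r normr_nat truncn_le normr_ge0. Qed.

Lemma trunc0_dist t : `|t - signed_nat (trunc0 t)| <= 1.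
Proof.
have /andP[h1 h2] := truncn_itv (normr_ge0 t).
rewrite {1}[t]numEsign -mulrBr normrM normr_sign mul1r.
by rewrite ger0_norm ?subr_ge0// lerBlDl natr1 ltW.
Qed.

(* The form at [y] is the form at the truncation [m] of the small coordinates
   [u] of [y], plus a rounding error [(u - m) (u + m)] bounded by the Schur test,
   plus the pairs with a large coordinate. *)
Lemma quad_form_bound a r y (k : nat) (p tau eta theta D E c : R) :
  (0 < k)%N -> 0 < tau -> 0 < eta <= 1 -> 0 < theta -> 0 <= c -> 0 <= D -> 0 <= p ->
  (forall i j, 0 <= a i j) -> (forall i j, 0 <= r i j <= p) ->
  (forall i j, a i j = a j i) -> (forall i j, r i j = r j i) ->
  (forall i, \sum_j (a i j + r i j) <= D) ->
  (forall U : {set 'I_n}, #|U|%:R * (eta ^+ 2 * tau) <= (k ^ 2 * n)%:R ->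
     \sum_(i in U) \sum_(j in U) a i j <= c * #|U|%:R) ->
  (forall m : 'I_n -> bool * nat,
     (forall i, signed_nat (m i) ^+ 2 <= tau) ->
     \sum_i signed_nat (m i) ^+ 2 <= (k ^ 2 * n)%:R ->
     \sum_i \sum_j (a i j - r i j) * (signed_nat (m i) * signed_nat (m j))
       <= E * (k ^ 2 * n)%:R) ->
  \sum_i y i ^+ 2 = (k ^ 2 * n)%:R ->
  \sum_i \sum_j (a i j - r i j) * (y i * y j) <=
    (E + 2 * D / k%:R + 2 * eta * D + c / eta +
     p * (theta * n%:R + k%:R ^+ 2 * n%:R / tau / theta)) * (k ^ 2 * n)%:R.
Proof.
move=> k0 tau0 eta01 th0 c0 D0 p0 a0 rp syma symr degD smallU net y2.
have /andP[eta0 eta1] := eta01.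
pose N : R := (k ^ 2 * n)%:R; rewrite -/N in smallU net y2 *.
have N0 : 0 <= N by rewrite ler0n.
have r0 i j : 0 <= r i j by case/andP: (rp i j).
pose b i j := a i j - r i j.
have symb i j : b i j = b j i by rewrite /b syma symr.
have bD i : \sum_j `|b i j| <= D.
  apply: le_trans (degD i); apply: ler_sum => j _.
  by apply: (le_trans (ler_normB _ _)); rewrite !ger0_norm.
pose big i := tau < y i ^+ 2.
pose u i := if big i then 0 else y i.
pose m i := signed_nat (trunc0 (u i)).
have mu i : m i ^+ 2 <= u i ^+ 2.
  by rewrite -(sqr_normr (m i)) -(sqr_normr (u i)) ler_sqr ?nnegrE// trunc0_abs.
have uy i : u i ^+ 2 <= y i ^+ 2.
  by rewrite /u; case: ifP => // _; rewrite expr0n sqr_ge0.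
have u_tau i : u i ^+ 2 <= tau.
  rewrite /u; case: ifP => [_|]; first by rewrite expr0n ltW.
  by move=> /negbT; rewrite -leNgt.
have u2 : \sum_i u i ^+ 2 <= N by rewrite -y2 ler_sum.
have m2 : \sum_i m i ^+ 2 <= N by apply: le_trans u2; rewrite ler_sum.
have grid : \sum_i \sum_j b i j * (m i * m j) <= E * N.
  by apply: net => // i; apply: le_trans (mu i) (u_tau i).
have rounding : \sum_i \sum_j b i j * ((u i - m i) * (u j + m j)) <=
    2 * D / k%:R * N.
  have kR : 0 < k%:R :> R by rewrite ltr0n.
  have h1 : \sum_i (u i - m i) ^+ 2 <= n%:R.
    rewrite -[n in n%:R]card_ord -sum1_card natr_sum ler_sum// => i _.
    by rewrite -(sqr_normr (u i - m i)) expr_le1// trunc0_dist.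
  have h2 : \sum_i (u i + m i) ^+ 2 <= 4 * N.
    apply: (@le_trans _ _ (\sum_i (2 * u i ^+ 2 + 2 * m i ^+ 2))).
      apply: ler_sum => i _; have := sqr_ge0 (u i - m i); rewrite sqrrB sqrrD; lra.
    rewrite big_split/= -!mulr_sumr; lra.
  (* The weight [2 * k] balances the squared norms, at most [n] for [u - m] and [4 * k ^ 2 * n] for
     [u + m]. *)
  have s0 : 0 < 2 * k%:R :> R by rewrite mulr_gt0.
  apply: le_trans (schur_test (fun i => u i - m i) (fun j => u j + m j) s0 symb
    bD) _.
  have h3 : 2 * k%:R * \sum_i (u i - m i) ^+ 2 <= 2 * k%:R * n%:R.
    by rewrite ler_wpM2l ?(ltW s0).
  have h4 : (2 * k%:R)^-1 * \sum_i (u i + m i) ^+ 2 <= (2 * k%:R)^-1 * (4 * N).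
    by rewrite ler_wpM2l ?invr_ge0 ?(ltW s0).
  have -> : 2 * D / k%:R * N =
      D * (2 * k%:R * n%:R + (2 * k%:R)^-1 * (4 * N)) / 2.
    by rewrite /N natrM natrX; field; rewrite gt_eqF.
  by rewrite ler_wpM2r ?invr_ge0// ler_wpM2l// lerD.
(* Only pairs with a large coordinate contribute: the part in [a] goes through [prod_le_balanced],
   the part in [r] through [amgm]. *)
have large : \sum_i \sum_j b i j * (y i * y j - u i * u j) <=
   (2 * eta * D + c / eta + p * (theta * n%:R + k%:R ^+ 2 * n%:R / tau /
     theta)) * N.
  pose w i := sq_above (eta ^+ 2 * tau) (y i).
  have w0 i : 0 <= w i by rewrite /w /sq_above; case: ifP => // _; rewrite sqr_ge0.
  pose h (i j : 'I_n) : R := (theta * y i ^+ 2 + y j ^+ 2 / theta) / 2 *+ big i.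
  have amgm i j : `|y i * y j| <= (theta * y i ^+ 2 + y j ^+ 2 / theta) / 2.
    rewrite normrM -(sqr_normr (y i)) -(sqr_normr (y j)).
    have : 0 <= theta^-1 * (theta * `|y i| - `|y j|) ^+ 2.
      by rewrite mulr_ge0 ?invr_ge0 ?(ltW th0) ?sqr_ge0.
    have -> : theta^-1 * (theta * `|y i| - `|y j|) ^+ 2 =
       theta * `|y i| ^+ 2 - 2 * (`|y i| * `|y j|) + `|y j| ^+ 2 / theta.
      by field; rewrite gt_eqF.
    lra.
  have h0 i j : 0 <= h i j by rewrite mulrn_wge0// (le_trans _ (amgm i j)).
  have term i j : b i j * (y i * y j - u i * u j) <=
      (eta * (a i j * y i ^+ 2) + eta * (a i j * y j ^+ 2) +
       eta^-1 * (a i j * Num.min (w i) (w j))) + (p * h i j + p * h j i).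
    have A0 : 0 <= eta * (a i j * y i ^+ 2) + eta * (a i j * y j ^+ 2) +
       eta^-1 * (a i j * Num.min (w i) (w j)).
      have m0 : 0 <= Num.min (w i) (w j) by rewrite le_min !w0.
      have Q l : 0 <= eta * (a i j * y l ^+ 2).
        by rewrite mulr_ge0 ?(ltW eta0)// mulr_ge0 ?sqr_ge0.
      by rewrite addr_ge0 ?addr_ge0 ?Q// mulr_ge0 ?invr_ge0 ?(ltW eta0)// mulr_ge0.
    have P0 : 0 <= p * h i j + p * h j i by rewrite addr_ge0// mulr_ge0.
    have [/orP bij|] := boolP (big i || big j); last first.
      rewrite negb_or => /andP[/negPf bi /negPf bj].
      by rewrite /u bi bj subrr mulr0 addr_ge0.
    have -> : y i * y j - u i * u j = y i * y j.
      by case: bij => bb; rewrite /u bb ?mul0r ?mulr0 subr0.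
    rewrite /b mulrBl lerD//.
      have -> : eta * (a i j * y i ^+ 2) + eta * (a i j * y j ^+ 2) +
        eta^-1 * (a i j * Num.min (w i) (w j)) =
        a i j * (eta * (y i ^+ 2 + y j ^+ 2) + eta^-1 * Num.min (w i) (w j)) by
          ring.
      rewrite ler_wpM2l// (le_trans (ler_norm _))// normrM.
      by apply: prod_le_balanced => //; [exact: ltW|exact/orP].
    have rh : - (r i j * (y i * y j)) <= p * `|y i * y j|.
      apply: le_trans (ler_norm _) _; rewrite normrN normrM ler_wpM2r//.
      by rewrite ger0_norm//; case/andP: (rp i j).
    apply: (le_trans rh); rewrite -mulrDr ler_wpM2l//.
    case: bij => bb.
      by rewrite -[leLHS]addr0 lerD ?h0// /h bb amgm.
    by rewrite -[leLHS]add0r lerD ?h0// /h bb mulrC amgm.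
  apply: (le_trans (ler_sum _ (fun i _ => ler_sum _ (fun j _ => term i j)))).
  have sa i : \sum_j a i j <= D.
    by apply: le_trans (degD i); rewrite ler_sum// => j _; rewrite lerDl.
  have S1 : \sum_i \sum_j a i j * y i ^+ 2 <= D * N.
    rewrite -y2 mulr_sumr ler_sum// => i _.
    by rewrite -mulr_suml ler_wpM2r ?sqr_ge0.
  have S2 : \sum_i \sum_j a i j * y j ^+ 2 <= D * N.
    rewrite exchange_big/=; apply: le_trans S1.
    by apply: ler_sum => i _; apply: ler_sum => j _; rewrite syma.
  have S3 : \sum_i \sum_j a i j * Num.min (w i) (w j) <= c * N.
    have wN : \sum_i w i <= N.
      by rewrite -y2 ler_sum// => i _; rewrite /w /sq_above; case: ifP => // _;
        rewrite sqr_ge0.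
    (* Where [w] is positive it is at least [eta ^+ 2 * tau]; as its total is at most [N], such a
       [U] is small enough for [smallU]. *)
    apply: le_trans (ler_wpM2l c0 wN); apply: sum_min_le => // U Uw.
    apply: smallU; apply: le_trans wN.
    rewrite (bigID (mem U))/= -[leLHS]addr0 lerD//; last by rewrite sumr_ge0.
    rewrite -sum1_card natr_sum mulr_suml ler_sum// => i /Uw.
    by rewrite mul1r /w /sq_above; case: ifP => //; rewrite ltxx.
  have S4 : \sum_i \sum_j h i j <= (theta * n%:R + k%:R ^+ 2 * n%:R / tau /
    theta) * N / 2.
    have row i : \sum_j h i j <=
        y i ^+ 2 * ((theta * n%:R + k%:R ^+ 2 * n%:R / tau / theta) / 2).
      have NE : k%:R ^+ 2 * n%:R = N by rewrite /N natrM natrX.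
      have X0 : 0 <= theta * n%:R + N / tau / theta.
        by rewrite addr_ge0 ?mulr_ge0 ?invr_ge0 ?(ltW th0) ?(ltW tau0).
      rewrite NE /h; have [bi|_] := boolP (big i); last first.
        rewrite big1 => [|j _]; last by rewrite mulr0n.
        by rewrite mulr_ge0 ?sqr_ge0// divr_ge0.
      have -> : \sum_(j < n) (theta * y i ^+ 2 + y j ^+ 2 / theta) / 2 *+ true =
          (theta * y i ^+ 2 * n%:R + N / theta) / 2.
        rewrite -y2 -mulr_suml big_split/= sumr_const card_ord -mulr_suml.
        by rewrite mulr_natr.
      (* A large [i] has [1 <= y i ^+ 2 / tau], which turns the term without [y i] into a multiple
         of [y i ^+ 2]. *)
      have : N / theta <= y i ^+ 2 * (N / tau / theta).
        have -> : y i ^+ 2 * (N / tau / theta) = y i ^+ 2 / tau * (N / theta)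
          by ring.
        rewrite ler_peMl ?divr_ge0 ?(ltW th0)//.
        by rewrite ler_pdivlMr// mul1r ltW.
      lra.
    apply: (le_trans (ler_sum _ (fun i _ => row i))).
    by rewrite -mulr_suml y2 le_eqVlt; apply/orP; left; apply/eqP; ring.
  have S5 : \sum_i \sum_j h j i <= (theta * n%:R + k%:R ^+ 2 * n%:R / tau /
    theta) * N / 2.
    by rewrite exchange_big.
  have -> : \sum_i \sum_j ((eta * (a i j * y i ^+ 2) + eta * (a i j * y j ^+ 2) +
       eta^-1 * (a i j * Num.min (w i) (w j))) + (p * h i j + p * h j i)) =
    eta * (\sum_i \sum_j a i j * y i ^+ 2) + eta * (\sum_i \sum_j a i j * y j
      ^+ 2) +
    eta^-1 * (\sum_i \sum_j a i j * Num.min (w i) (w j)) +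
    (p * (\sum_i \sum_j h i j) + p * (\sum_i \sum_j h j i)).
    rewrite !mulr_sumr -!big_split/=; apply: eq_bigr => i _.
    by rewrite !mulr_sumr -!big_split.
  have := ler_wpM2l (ltW eta0) S1; have := ler_wpM2l (ltW eta0) S2.
  have ei : 0 <= eta^-1 by rewrite invr_ge0 ltW.
  have := ler_wpM2l ei S3; have := ler_wpM2l p0 S4; have := ler_wpM2l p0 S5.
  lra.
have -> : \sum_i \sum_j (a i j - r i j) * (y i * y j) =
  \sum_i \sum_j b i j * (m i * m j) +
  \sum_i \sum_j b i j * ((u i - m i) * (u j + m j)) +
  \sum_i \sum_j b i j * (y i * y j - u i * u j).
  (* By symmetry of [b], the mixed terms of [(u i - m i) * (u j + m j)] cancel in the sum. *)
  have cross : \sum_i \sum_j b i j * (u i * m j) = \sum_i \sum_j b i j * (m i *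
    u j).
    rewrite exchange_big; apply: eq_bigr => i _; apply: eq_bigr => j _.
    by rewrite symb [u j * _]mulrC.
  rewrite -!big_split/= -[LHS]addr0 -[X in _ + X](subrr (\sum_i \sum_j b i j *
    (u i * m j))).
  rewrite [X in _ + (_ - X)]cross -sumrB -big_split/=; apply: eq_bigr => i _.
  rewrite -!big_split/= -sumrB -big_split/=; apply: eq_bigr => j _.
  by rewrite -/(b i j); ring.
lra.
Qed.
End Deterministic.

(** * The dual certificate *)

Section Certificate.
Variables (R : realType) (n : nat).
Implicit Types (G : sgraph n) (x : signs n) (y : 'cV[R]_n).

Definition sgn x i : R := (-1) ^+ x i.

(** The dual slack matrix at [x] of the semidefinite relaxation of minimum bisection. *)
Definition dual_mx G x : 'M[R]_n :=
  let B := signed_adjmx R G in let X := diag_mx (pm1 R x)^T in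
  row_sum_diag (X *m B *m X) - B.

Lemma pm1E x i : pm1 R x i 0 = sgn x i.
Proof. by rewrite mxE. Qed.

Lemma sgn2 x i : sgn x i ^+ 2 = 1.
Proof. exact: sqrr_sign. Qed.

Lemma signed_adjmxE G i j :
  signed_adjmx R G i j = 2 * (adj G i j)%:R - 1 + (i == j)%:R.
Proof. by rewrite !mxE big_ord1 !mxE mulr1; ring. Qed.

Lemma signed_adjmx_sym G i j : signed_adjmx R G i j = signed_adjmx R G j i.
Proof. by rewrite !signed_adjmxE adj_sym eq_sym. Qed.

Lemma diag_conjE G x i j :
  (diag_mx (pm1 R x)^T *m signed_adjmx R G *m diag_mx (pm1 R x)^T) i j =
  sgn x i * signed_adjmx R G i j * sgn x j.
Proof. by rewrite mul_mx_diag mxE mul_diag_mx !mxE. Qed.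

Lemma dual_mxE G x i j : dual_mx G x i j =
  (\sum_k sgn x i * signed_adjmx R G i k * sgn x k) *+ (i == j)
  - signed_adjmx R G i j.
Proof.
rewrite /dual_mx /row_sum_diag; set A := _ *m diag_mx _; rewrite !mxE.
by under eq_bigr do rewrite diag_conjE.
Qed.

Lemma sum_delta (a : R) (f : 'I_n -> R) i : \sum_j a *+ (i == j) * f j = a * f i.
Proof.
rewrite (bigD1 i)//= big1 ?addr0 ?eqxx ?mulr1n// => j /negPf ji.
by rewrite eq_sym ji mulr0n mul0r.
Qed.

Lemma dual_mx_sym G x : (dual_mx G x)^T = dual_mx G x.
Proof.
apply/matrixP => i j; rewrite mxE !dual_mxE signed_adjmx_sym.
by case: eqVneq => [->|]; rewrite ?mulr0n//.
Qed.

Lemma mul_dual_mx G x : dual_mx G x *m pm1 R x = 0.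
Proof.
apply/colP => i; rewrite !mxE.
under eq_bigr do rewrite dual_mxE pm1E mulrBl.
rewrite sumrB sum_delta mulr_suml -sumrB big1// => j _.
rewrite -[X in _ - X]mul1r -(sgn2 x i); ring.
Qed.

Lemma quadE (B : 'M[R]_n) y : quad B y = \sum_i \sum_j B i j * (y i 0 * y j 0).
Proof.
rewrite /quad mxE; under eq_bigr do rewrite mxE mulr_suml.
rewrite exchange_big; apply: eq_bigr => i _; apply: eq_bigr => j _ /=.
by rewrite mxE; ring.
Qed.

Lemma quad_dual_mx G x y : quad (dual_mx G x) y =
  \sum_i (\sum_k sgn x i * signed_adjmx R G i k * sgn x k) * y i 0 ^+ 2
  - quad (signed_adjmx R G) y.
Proof.
rewrite !quadE -sumrB; apply: eq_bigr => i _.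
under eq_bigr do rewrite dual_mxE mulrBl.
by rewrite sumrB sum_delta expr2.
Qed.

(** With [y i 0 ^+ 2 = 1], the diagonal part of the form is the same for all [y], namely the
    objective at [x]. *)
Lemma quad_dual_bisection G x y : bisection y ->
  quad (dual_mx G x) y = quad (signed_adjmx R G) (pm1 R x) - quad (signed_adjmx
    R G) y.
Proof.
move=> [y2 _]; rewrite quad_dual_mx; congr (_ - _); rewrite quadE.
apply: eq_bigr => i _; rewrite y2 mulr1; apply: eq_bigr => j _.
by rewrite !pm1E; ring.
Qed.

Lemma certifiesE G x : certifies R G x =
  (\sum_i sgn x i == 0) && (0 < lambda2 (dual_mx G x)).
Proof.
rewrite /certifies /=; congr ((_ == 0) && _); rewrite mxE.
by apply: eq_bigr => i _; rewrite !mxE mulr1.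
Qed.

Lemma certifies_min_bisection G x : certifies R G x -> min_bisection R G x.
Proof.
rewrite certifiesE => /andP[/eqP sum0 l2]; split.
  split=> [i|]; first by rewrite pm1E sgn2.
  by under eq_bigr do rewrite pm1E.
(* For [n = 0] there is a single vector; otherwise [x] is a nonzero null vector. *)
move=> y biy; have [n0|n0] := posnP n.
  by suff -> : y = pm1 R x by []; apply/colP => i; have := ltn_ord i; rewrite {2}n0.
have x0 : pm1 R x != 0.
  apply/eqP => /colP/(_ (Ordinal n0)); rewrite pm1E mxE => /eqP.
  by rewrite signr_eq0.
have := psd_of_lambda2_gt0 (dual_mx_sym G x) x0 (mul_dual_mx G x) l2 y.
by rewrite -/(quad _ _) quad_dual_bisection// subr_ge0.
Qed.

Definition strictly_dual_feasible G x := forall y, y != 0 ->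
  \sum_i sgn x i * y i 0 = 0 -> 0 < quad (dual_mx G x) y.

Lemma equal_clusters_sum (g : signs n) : equal_clusters g -> \sum_i sgn g i = 0.
Proof.
move=> clus; rewrite (bigID (fun i => g i))/= /sgn.
have half b : \sum_(i | g i == b) (1 : R) = n./2%:R.
  rewrite sumr_const -(clus b) -[#|_|]/#|[pred i | g i == b]|; congr _%:R.
  by apply: eq_card => i; rewrite !inE.
have -> : \sum_(i | g i) (-1) ^+ g i = - \sum_(i | g i == true) (1 : R).
  by rewrite -sumrN; apply: eq_big => [i|i ->//]; rewrite eqb_id.
have -> : \sum_(i | ~~ g i) (-1) ^+ g i = \sum_(i | g i == false) (1 : R).
  by apply: eq_big => [i|i /negPf->//]; rewrite eqbF_neg.
by rewrite !half addNr.
Qed.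

Lemma equal_clusters_bisection (g : signs n) : equal_clusters g -> bisection
  (pm1 R g).
Proof.
move=> clus; split=> [i|]; first by rewrite pm1E sgn2.
by under eq_bigr do rewrite pm1E; exact: equal_clusters_sum.
Qed.

(** Let [y] be the component of [x] orthogonal to [g]. The form of [dual_mx G g] has the same value
    at [y] and at [x], nonpositive by optimality of [x]; so [y = 0] and [x] is [g] up to sign. *)
Lemma min_bisection_certifies G (g x : signs n) : (0 < n)%N -> ~~ odd n ->
  bisection (pm1 R g) -> strictly_dual_feasible G g ->
  min_bisection R G x -> certifies R G x.
Proof.
move=> n0 evn big posg [bix optx].
have nR : n%:R != 0 :> R by rewrite pnatr_eq0 -lt0n.
pose c := (\sum_i sgn g i * sgn x i) / n%:R.
pose y : 'cV[R]_n := pm1 R x - c *: pm1 R g.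
have yg : \sum_i sgn g i * y i 0 = 0.
  have e i : sgn g i * y i 0 = sgn g i * sgn x i - c.
    by rewrite !mxE; have := sgn2 g i; rewrite expr2 => gg;
      rewrite mulrBr (mulrCA _ c) gg mulr1.
  under eq_bigr do rewrite e.
  by rewrite sumrB sumr_const card_ord /c -[X in _ - X]mulr_natr divfK ?subrr.
have quad_y : quad (dual_mx G g) y = quad (dual_mx G g) (pm1 R x).
  rewrite /quad /y -mulmxA mulmxBr -scalemxAr mul_dual_mx scaler0 subr0.
  have gM : (pm1 R g)^T *m dual_mx G g = 0.
    by rewrite -dual_mx_sym -trmx_mul mul_dual_mx trmx0.
  have -> : (pm1 R x - c *: pm1 R g)^T = (pm1 R x)^T - c *: (pm1 R g)^T.
    by apply/matrixP => i j; rewrite !mxE.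
  by rewrite mulmxBl -scalemxAl !mulmxA gM mul0mx scaler0 subr0.
have y0 : y = 0.
  apply/eqP; apply/negP => /negP/posg/(_ yg).
  by rewrite quad_y quad_dual_bisection// subr_gt0 ltNge optx.
have xg i : sgn x i = c * sgn g i.
  have /colP/(_ i) := y0; rewrite !mxE => /eqP.
  by rewrite subr_eq0 => /eqP.
have c2 : c ^+ 2 = 1.
  have := sgn2 x (Ordinal n0); rewrite xg exprMn sgn2 mulr1; exact.
rewrite certifiesE; apply/andP; split.
  by case: bix => _; under eq_bigr do rewrite pm1E; move=> ->.
(* Signs enter only through products of two entries, so the factor [c ^+ 2 = 1] disappears. *)
have -> : dual_mx G x = dual_mx G g.
  apply/matrixP => i j; rewrite !dual_mxE; congr (_ *+ _ - _).
  apply: eq_bigr => k _; rewrite !xg -[RHS]mul1r -c2; ring.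
apply: (@lambda2_gt0 _ _ _ (pm1 R g)); [|exact: dual_mx_sym|].
  by move: n0 evn; case: (n) => [|[|?]].
move=> z z0 zg; apply: posg => //; rewrite -[RHS]zg mxE.
by apply: eq_bigr => i _; rewrite !mxE mulrC.
Qed.

Variables (g : signs n) (p q : R).
Hypotheses (p0 : 0 <= p) (pq1 : p + q <= 1).

Lemma edge_probE i j :
  edge_prob g p q i j = (p + q) / 2 + (p - q) / 2 * (sgn g i * sgn g j).
Proof.
rewrite /edge_prob -signr_addb; case: (g i) (g j) => [] [] /=;
  rewrite ?expr0 ?expr1; lra.
Qed.

(** For [y] orthogonal to [g], with [N] its squared norm and [s] its sum, the form is [2 * (\sum_i d
    i * y i 0 ^+ 2 - Q) + 2 * p * N + (1 - (p + q)) * s ^+ 2], where [Q] is the centered form. *)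
Lemma strictly_dual_feasible_intro G (T : R) : \sum_i sgn g i = 0 ->
  (forall i, T < \sum_j (adj G i j)%:R * (sgn g i * sgn g j)) ->
  (forall y : 'I_n -> R, \sum_i \sum_j
     ((adj G i j)%:R - edge_prob g p q i j *+ (i != j)) * (y i * y j)
     <= T * \sum_i y i ^+ 2) ->
  strictly_dual_feasible G g.
Proof.
move=> g0 gap bound y y0 yg.
pose f i := y i 0; pose N := \sum_i f i ^+ 2; pose s := \sum_i f i.
pose d i := \sum_j (adj G i j)%:R * (sgn g i * sgn g j).
pose Q := \sum_i \sum_j ((adj G i j)%:R - edge_prob g p q i j *+ (i != j)) * (f
  i * f j).
(* The all-ones part vanishes because [g] is balanced; the identity contributes the [1]. *)
have rowE i : \sum_k sgn g i * signed_adjmx R G i k * sgn g k = 2 * d i + 1.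
  have -> : 2 * d i + 1 = 2 * d i - sgn g i * (\sum_k sgn g k) +
      \sum_k sgn g i * (i == k)%:R * sgn g k.
    rewrite g0 mulr0 subr0 (bigD1 i)//= eqxx mulr1 -expr2 sgn2 big1 ?addr0// =>
      k /negPf ki.
    by rewrite eq_sym ki mulr0 mul0r.
  rewrite /d !mulr_sumr -sumrB -big_split/=; apply: eq_bigr => k _.
  by rewrite signed_adjmxE; ring.
(* The mean is [edge_probE] minus [p] on the diagonal; its part along [g] is killed by [yg]. *)
have sumE : quad (signed_adjmx R G) y = 2 * Q - 2 * p * N +
     (p + q) * s ^+ 2 - s ^+ 2 + N.
  have sE : s ^+ 2 = \sum_i \sum_j f i * f j by rewrite expr2 big_distrlr.
  have gE : 0 = \sum_i \sum_j (sgn g i * f i) * (sgn g j * f j).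
    by rewrite -big_distrlr /= yg mulr0.
  have NE c : c * N = \sum_i \sum_j (c * (f i * f j)) *+ (i == j).
    rewrite mulr_sumr; apply: eq_bigr => i _.
    by rewrite (bigD1 i)//= eqxx big1 ?addr0 ?expr2// => j /negPf ji;
      rewrite eq_sym ji.
  have -> : 2 * Q - 2 * p * N + (p + q) * s ^+ 2 - s ^+ 2 + N =
    2 * Q + (1 - 2 * p) * N + (p + q - 1) * s ^+ 2 + (p - q) * 0 by ring.
  rewrite [X in _ + (p - q) * X]gE NE sE /Q !mulr_sumr -!big_split/= quadE;
    apply: eq_bigr => i _.
  rewrite !mulr_sumr -!big_split/=; apply: eq_bigr => j _.
  rewrite signed_adjmxE edge_probE -/(f i) -/(f j).
  case: eqVneq => [<-|_]; last by rewrite !mulr1n ?mulr0n; field.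
  have := sgn2 g i; rewrite expr2 => gg; rewrite adj_irr /= mulr0n mulr1n.
  have -> : sgn g i * f i * (sgn g i * f i) = f i * f i by rewrite mulrACA gg mul1r.
  ring.
rewrite quad_dual_mx sumE.
under eq_bigr do rewrite rowE -/(f _).
have [i0 fi0] : exists i, f i != 0.
  apply/existsP; apply: contraNT y0; rewrite negb_exists => /forallP f0.
  by apply/eqP/colP => i; rewrite mxE; apply/eqP; have := f0 i; rewrite negbK.
have fi2 : 0 < f i0 ^+ 2 by rewrite lt_def sqrf_eq0 fi0 sqr_ge0.
have N0 : 0 < N.
  by rewrite /N (bigD1 i0)//= ltr_pwDl// sumr_ge0// => i _; rewrite sqr_ge0.
have dT : T * N < \sum_i d i * f i ^+ 2.
  rewrite mulr_sumr (bigD1 i0)//= [ltRHS](bigD1 i0)//= ltr_leD//.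
    by rewrite ltr_pM2r//; exact: gap.
  by apply: ler_sum => i _; rewrite ler_wpM2r ?sqr_ge0// ltW//; exact: gap.
have -> : \sum_i (2 * d i + 1) * f i ^+ 2 = 2 * (\sum_i d i * f i ^+ 2) + N.
  by rewrite mulr_sumr -big_split/=; apply: eq_bigr => i _; ring.
have QN : Q <= T * N := bound f.
have := mulr_ge0 p0 (ltW N0).
have : 0 <= (1 - (p + q)) * s ^+ 2 by rewrite mulr_ge0 ?sqr_ge0// subr_ge0.
lra.
Qed.
End Certificate.

(** * Union bounds *)

Section Concentration.
Variables (R : realType) (n : nat) (g : signs n) (alpha beta L p q : R).
Hypotheses (n_gt0 : (0 < n)%N) (L_gt0 : 0 < L) (expL : expR L = n%:R).
Hypotheses (q_ge0 : 0 <= q) (qp : q <= p) (pq1 : p + q <= 1).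
Hypotheses (npE : n%:R * p = alpha * L) (nqE : n%:R * q = beta * L).
Local Notation Pr := (sbm_prob g p q).
Local Notation a G i j := ((adj (G : sgraph n) i j)%:R : R).

Let p_ge0 : 0 <= p. Proof. exact: le_trans qp. Qed.
Let p01 : 0 <= p <= 1.
Proof. by rewrite p_ge0 (le_trans _ pq1)// lerDl. Qed.
Let q01 : 0 <= q <= 1.
Proof. by rewrite q_ge0 (le_trans _ pq1)// lerDr. Qed.

(** Chernoff's bound with weights [- t] inside the cluster of [i] and [t] across, each group being
    [n / 2] vertices. The [L] in the exponent pays for the union over [n] vertices. *)
Lemma gap_union (t v : R) : ~~ odd n -> equal_clusters g -> 0 <= t ->
  Pr (fun G => [exists i, \sum_j a G i j * (sgn R g i * sgn R g j) <= v]) <=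
  expR (L + 1 + t * v +
    L / 2 * (alpha * (expR (- t) - 1) + beta * (expR t - 1))).
Proof.
move=> evn clus t0; set X := alpha * _ + _.
apply: (@le_trans _ _ (\sum_(i < n) expR (1 + t * v + L / 2 * X))); last first.
  by rewrite sumr_const card_ord -[leLHS]mulr_natl -expL -expRD !addrA.
apply: le_trans (le_trans (sbm_prob_union g p01 q01 predT
  (fun i G => \sum_j a G i j * (sgn R g i * sgn R g j) <= v)) _).
  by apply: sbm_prob_le => // G; apply: sub_existsb => i.
apply: ler_sum => i _.
have := star_chernoff g p01 q01 i (fun j => - t * (sgn R g i * sgn R g j)) (-
  (t * v)).
move=> h; apply: le_trans (le_trans h _).
  apply: sbm_prob_le => // G hG.
  have -> : \sum_j - t * (sgn R g i * sgn R g j) * a G i j =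
     - (t * \sum_j a G i j * (sgn R g i * sgn R g j)).
    by rewrite mulr_sumr -sumrN; apply: eq_bigr => j _; ring.
  by rewrite lerN2 ler_wpM2l.
rewrite ler_expR opprK.
pose F (b : bool) : R := if b then p * (expR (- t) - 1) else q * (expR t - 1).
have FE j : edge_prob g p q i j * (expR (- t * (sgn R g i * sgn R g j)) - 1) =
  F (g i == g j).
  rewrite /edge_prob /sgn -signr_addb /F.
  by case: (g i) (g j) => [] [] /=; rewrite ?expr0 ?expr1 ?mulr1 ?mulrN1 ?opprK.
under eq_bigr do rewrite FE.
have tot : \sum_j F (g i == g j) = L / 2 * X.
  rewrite (bigID (fun j => g i == g j))/=.
  have half b : \sum_(j | g j == b) (1 : R) = n%:R / 2.
    rewrite sumr_const -[#|_|]/#|[pred j | g j == b]|.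
    have -> : #|[pred j | g j == b]| = n./2.
      by rewrite -(clus b); apply: eq_card => j; rewrite !inE.
    by rewrite -[in RHS](odd_double_half n) (negPf evn) add0n -muln2 natrM
      mulfK// pnatr_eq0.
  have -> : \sum_(j | g i == g j) F (g i == g j) = n%:R / 2 * F true.
    rewrite -(half (g i)) mulr_suml; apply: eq_big => [j|j ->];
      first by rewrite eq_sym.
    by rewrite mul1r.
  have -> : \sum_(j | g i != g j) F (g i == g j) = n%:R / 2 * F false.
    rewrite -(half (~~ g i)) mulr_suml; apply: eq_big => [j|j /negPf->];
      last by rewrite mul1r.
    by case: (g i) (g j) => [] [].
  rewrite /F; have -> : n%:R / 2 * (p * (expR (- t) - 1)) + n%:R / 2 * (q *
    (expR t - 1)) =
    ((n%:R * p) * (expR (- t) - 1) + (n%:R * q) * (expR t - 1)) / 2 by ring.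
  by rewrite npE nqE /X; ring.
(* The star omits [j = i], whose term would be at least [- 1]; the [1] in the exponent
   compensates. *)
have := tot; rewrite (bigD1 i)//= eqxx /F => <-.
rewrite [in leRHS](addrC 1) -!addrA lerD2l addrA [1 + _]addrC.
rewrite lerDr.
have : 0 <= p * expR (- t) by rewrite mulr_ge0 ?expR_ge0.
have /andP[_] := p01; lra.
Qed.

Lemma degree_union (v : R) :
  Pr (fun G => [exists i, v <= \sum_j a G i j]) <=
  expR (L - v + alpha * L * expR 1).
Proof.
apply: (@le_trans _ _ (\sum_(i < n) expR (- v + alpha * L * expR 1))); last first.
  by rewrite sumr_const card_ord -[leLHS]mulr_natl -expL -expRD !addrA.
apply: le_trans (le_trans (sbm_prob_union g p01 q01 predT
  (fun i G => v <= \sum_j a G i j)) _).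
  by apply: sbm_prob_le => // G; apply: sub_existsb => i.
by apply: ler_sum => i _; have := degree_tail g p01 q01 qp i v; rewrite npE.
Qed.

(* Each nonempty [U] fails with probability at most [exp (- 2 L #|U|)]; these
   bounds sum to at most [exp (- L) (1 + 1/n)^n]. *)
Lemma induced_edges_union (s c : R) : 0 < s -> 0 < c ->
  alpha * expR (6 / c) / (2 * s) <= L ->
  Pr (fun G => [exists U : {set 'I_n}, (#|U|%:R * (s * L) <= n%:R) &&
     (c * L * #|U|%:R < \sum_(i in U) \sum_(j in U) a G i j)]) <=
  expR (1 - L).
Proof.
(* This [lam] makes the linear part of the exponent [- 3 * L * #|U|]; by [largeL] the quadratic part
   costs at most one [L * #|U|]. *)
move=> s0 c0 largeL; set lam := 6 / c in largeL.
have lam0 : 0 <= lam by rewrite divr_ge0 ?(ltW c0).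
pose P (U : {set 'I_n}) := (U != finset.set0) && (#|U|%:R * (s * L) <= n%:R).
apply: le_trans (le_trans (sbm_prob_union g p01 q01 P
  (fun U G => c * L * #|U|%:R <= \sum_(i in U) \sum_(j in U) a G i j)) _).
  apply: sbm_prob_le => // G /existsP[U /andP[sU aU]]; apply/existsP; exists U.
  rewrite /P sU (ltW aU) !andbT; apply: contraTneq aU => ->.
  by rewrite cards0 mulr0 big_set0 ltxx.
have bound U : P U -> Pr (fun G => c * L * #|U|%:R <= \sum_(i in U) \sum_(j in
  U) a G i j)
    <= expR (- L) * expR (- L) ^+ #|U|.
  move=> /andP[U0 sU].
  apply: (le_trans (induced_edges_tail g p01 q01 qp U (c * L * #|U|%:R) lam0)).
  rewrite -expRM_natl -expRD ler_expR.
  have u1 : 1 <= #|U|%:R :> R by rewrite ler1n card_gt0.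
  set u := #|U|%:R in sU u1 *.
  have -> : lam * (c * L * u) / 2 = 3 * L * u by rewrite /lam; field;
    rewrite gt_eqF.
  have pu : p * u <= alpha / s.
    rewrite ler_pdivlMr// -(ler_pM2r L_gt0) -npE.
    have -> : p * u * s * L = p * (u * (s * L)) by ring.
    by rewrite [n%:R * p]mulrC ler_wpM2l.
  have puu : p * u ^+ 2 * expR lam / 2 <= u * L.
    apply: le_trans (ler_wpM2l (le_trans ler01 u1) largeL).
    have -> : p * u ^+ 2 * expR lam / 2 = (p * u) * (u * (expR lam / 2)) by ring.
    have -> : u * (alpha * expR lam / (2 * s)) = alpha / s * (u * (expR lam / 2)).
      by field; rewrite gt_eqF.
    by rewrite ler_wpM2r// mulr_ge0 ?divr_ge0 ?expR_ge0// (le_trans ler01 u1).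
  have : L <= L * u by rewrite ler_peMr// ltW.
  lra.
apply: (le_trans (ler_sum _ bound)).
apply: (@le_trans _ _ (\sum_(U : {set 'I_n}) expR (- L) * expR (- L) ^+ #|U|)).
  rewrite [leLHS]big_mkcond; apply: ler_sum => U _; case: ifP => _;
    first exact: lexx.
  by rewrite mulr_ge0 ?exprn_ge0 ?expR_ge0.
rewrite -mulr_sumr addrC expRD ler_wpM2l ?expR_ge0//.
have -> : \sum_(U : {set 'I_n}) expR (- L) ^+ #|U| = \prod_(i < n) (expR (- L) + 1).
  rewrite bigA_distr; apply: eq_bigr => U _.
  by rewrite -big_mkcond /= prodr_const.
rewrite prodr_const card_ord.
apply: (@le_trans _ _ (expR (expR (- L)) ^+ n)).
  by rewrite lerXn2r ?nnegrE ?addr_ge0 ?expR_ge0// addrC expR_ge1Dx.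
by rewrite -expRM_natl expRN expL divff// gt_eqF ?ltr0n.
Qed.

Lemma signed_nat_sqr (m : bool * nat) : signed_nat R m ^+ 2 = (m.2 ^ 2)%:R.
Proof. by rewrite exprMn sqrr_sign mul1r natrX. Qed.

Lemma sum_half_powers (N : nat) : \sum_(k < N) 2^-1 ^+ k <= 2 :> R.
Proof.
suff : \sum_(k < N) 2^-1 ^+ k = 2 - 2 * 2^-1 ^+ N :> R.
  by move=> ->; rewrite gerBl mulr_ge0// exprn_ge0// invr_ge0.
elim: N => [|N IH]; first by rewrite big_ord0 expr0; lra.
by rewrite big_ord_recr/= IH exprS; field.
Qed.

(** In the ball the absolute values sum to at most [K * n], so the weight
    [2 ^+ (K * n) * \prod_i 2^-1 ^+ (m i).2] is at least 1. Its sum over all points factors into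
    coordinates, each contributing at most 4. *)
Lemma card_lattice_ball (N K : nat) :
  \sum_(m : {ffun 'I_n -> bool * 'I_N} | (\sum_i (m i).2 ^ 2 <= K * n)%N) 1
  <= expR ((K%:R + 2) * n%:R) :> R.
Proof.
apply: (@le_trans _ _ (\sum_(m : {ffun 'I_n -> bool * 'I_N})
   2 ^+ (K * n) * \prod_i 2^-1 ^+ (m i).2)).
  rewrite [leLHS]big_mkcond ler_sum// => m _; case: ifP => [mK|_]; last first.
    by rewrite mulr_ge0 ?exprn_ge0// prodr_ge0// => i _;
      rewrite exprn_ge0// invr_ge0.
  rewrite prodrXr exprVn ler_pdivlMr ?exprn_gt0// mul1r ler_weXn2l ?ler1n//.
  apply: leq_trans mK; apply: leq_sum => i _.
  by rewrite -mulnn; case: (nat_of_ord _) => // k; rewrite leq_pmulr.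
rewrite -mulr_sumr -(bigA_distr_bigA (fun i (t : bool * 'I_N) => 2^-1 ^+ t.2)) /=.
rewrite prodr_const card_ord.
have -> : \sum_(t : bool * 'I_N) 2^-1 ^+ t.2 = 2 * \sum_(k < N) 2^-1 ^+ k :> R.
  rewrite -(pair_bigA _ (fun (b : bool) (k : 'I_N) => 2^-1 ^+ k)) /=.
  by rewrite big_bool /= mulr_natl mulr2n.
apply: (@le_trans _ _ (2 ^+ (K * n) * (2 * 2) ^+ n)).
  rewrite ler_wpM2l ?exprn_ge0// lerXn2r ?nnegrE ?mulr_ge0//.
    by rewrite sumr_ge0// => k _; rewrite exprn_ge0// invr_ge0.
  by rewrite ler_wpM2l// sum_half_powers.
have -> : 2 ^+ (K * n) * (2 * 2) ^+ n = 2 ^+ ((K + 2) * n) :> R.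
  by rewrite -expr2 -exprM -exprD mulnDl.
apply: (@le_trans _ _ (expR 1 ^+ ((K + 2) * n))).
  by rewrite lerXn2r ?nnegrE ?expR_ge0//; apply: le_trans (expR_ge1Dx 1).
by rewrite -expRM_natl mulr1 natrM natrD.
Qed.

(** The parameter of [centered_form_tail] is [(2 * tau)^-1], as products of two coordinates are at
    most [tau]; the count of points is [card_lattice_ball]. *)
Lemma net_union (K : nat) (tau v : R) : 0 < tau ->
  Pr (fun G => `[< exists m : 'I_n -> bool * nat,
     [/\ forall i, signed_nat R (m i) ^+ 2 <= tau,
      \sum_i signed_nat R (m i) ^+ 2 <= (K * n)%:R &
      v < \sum_i \sum_j (a G i j - edge_prob g p q i j *+ (i != j)) *
        (signed_nat R (m i) * signed_nat R (m j))] >]) <=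
  expR ((K%:R + 2) * n%:R - v / (4 * tau) + p * ((K * n)%:R / (2 * tau)) ^+ 2).
Proof.
(* A natural number is at most its square, so every coordinate in the ball is at most [K * n] and
   fits in ['I_N]. *)
move=> tau0; pose N := (K * n).+1.
pose f (m : {ffun 'I_n -> bool * 'I_N}) i := signed_nat R ((m i).1, val (m i).2).
pose P m := [forall i, f m i ^+ 2 <= tau] && (\sum_i (m i).2 ^ 2 <= K * n)%N.
pose form (h : 'I_n -> R) (G : sgraph n) :=
  \sum_i \sum_j (a G i j - edge_prob g p q i j *+ (i != j)) * (h i * h j).
have f2 m : P m -> \sum_i f m i ^+ 2 <= (K * n)%:R.
  move=> /andP[_ mK]; under eq_bigr do rewrite signed_nat_sqr.
  by rewrite -natr_sum ler_nat.
apply: le_trans (le_trans (sbm_prob_union g p01 q01 P (fun m G => v <= form (f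
  m) G)) _).
  apply: sbm_prob_le => // G /asboolP[m [mtau mK vm]]; apply/existsP.
  have mKn : (\sum_i (m i).2 ^ 2 <= K * n)%N.
    rewrite -(ler_nat R) natr_sum; apply: le_trans mK.
    by apply: ler_sum => i _; rewrite signed_nat_sqr.
  have mN i : ((m i).2 < N)%N.
    rewrite ltnS; apply: leq_trans mKn; rewrite (bigD1 i)//=.
    apply: leq_trans (leq_addr _ _); by rewrite -mulnn; case: ((m i).2) => // k;
      rewrite leq_pmulr.
  pose m' := [ffun i => ((m i).1, Ordinal (mN i))].
  have fm i : f m' i = signed_nat R (m i) by rewrite /f ffunE /=
    -surjective_pairing.
  exists m'; apply/andP; split; last first.
    by rewrite /form; under eq_bigr do under eq_bigr do rewrite !fm; exact: ltW.
  apply/andP; split; first by apply/forallP => i; rewrite fm.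
  by under eq_bigr do rewrite ffunE.
have bound m : P m -> Pr (fun G => v <= form (f m) G) <=
    1 * expR (- (v / (4 * tau)) + p * ((K * n)%:R / (2 * tau)) ^+ 2).
  move=> Pm; have /andP[/forallP mtau _] := Pm.
  have tau2 : 0 <= (2 * tau)^-1 by rewrite invr_ge0 mulr_ge0// ltW.
  have small i j : `|(2 * tau)^-1 * (f m i * f m j)| <= 2^-1.
    rewrite normrM (ger0_norm tau2) invfM -mulrA ler_piMr ?invr_ge0//.
    rewrite ler_pdivrMl// mulr1 normrM.
    have := mtau i; have := mtau j; have := sqr_ge0 (`|f m i| - `|f m j|).
    rewrite sqrrB -!(sqr_normr (f m _)); lra.
  apply: (le_trans (centered_form_tail g p01 q01 qp v small tau2)).
  rewrite mul1r ler_expR; apply: lerD.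
    by rewrite le_eqVlt; apply/orP; left; apply/eqP; field; rewrite gt_eqF.
  rewrite -mulrA ler_wpM2l// -exprMn mulrC lerXn2r ?nnegrE ?mulr_ge0 ?sumr_ge0//.
    by move=> i _; rewrite sqr_ge0.
  by rewrite ler_wpM2r// f2.
apply: (le_trans (ler_sum _ bound)).
rewrite -mulr_suml -[in leRHS]addrA [leRHS]expRD ler_wpM2r ?expR_ge0//.
apply: le_trans (card_lattice_ball N K).
rewrite [leLHS]big_mkcond [leRHS]big_mkcond ler_sum// => m _.
by rewrite /P; case: (\sum_i _ <= _)%N; rewrite ?andbF// andbT; case: ifP.
Qed.


(** By homogeneity [y] is rescaled to squared norm [k ^ 2 * n], which makes rounding to integers an
    error of relative order [1 / k]. Net, rounding, sparse part and mean each cost [eps * L]. *)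
Lemma quad_form_good G (k : nat) (eps C eta c kappa theta : R) :
  0 <= alpha -> (0 < k)%N -> 0 <= C -> 0 < eta <= 1 -> 0 < c ->
  0 < kappa -> 0 < theta ->
  2 * (C + alpha) / k%:R <= eps -> 2 * eta * (C + alpha) + c / eta <= eps ->
  alpha * theta + alpha / (kappa * theta * L) <= eps ->
  (forall i, \sum_j a G i j <= C * L) ->
  (forall U : {set 'I_n}, #|U|%:R * (eta ^+ 2 * kappa * L) <= n%:R ->
    \sum_(i in U) \sum_(j in U) a G i j <= c * L * #|U|%:R) ->
  (forall m : 'I_n -> bool * nat,
    (forall i, signed_nat R (m i) ^+ 2 <= kappa * (k ^ 2)%:R * L) ->
    \sum_i signed_nat R (m i) ^+ 2 <= (k ^ 2 * n)%:R ->
    \sum_i \sum_j (a G i j - edge_prob g p q i j *+ (i != j)) *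
        (signed_nat R (m i) * signed_nat R (m j)) <= eps * L * (k ^ 2 * n)%:R) ->
  forall y : 'I_n -> R,
    \sum_i \sum_j (a G i j - edge_prob g p q i j *+ (i != j)) * (y i * y j)
    <= 4 * eps * L * \sum_i y i ^+ 2.
Proof.
move=> al0 k0 C0 eta01 c0 kap0 th0 hk heta hth deg small net y.
have kR : 0 < k%:R :> R by rewrite ltr0n.
have k2R : 0 < (k ^ 2)%:R :> R by rewrite ltr0n expn_gt0 k0.
pose N : R := (k ^ 2 * n)%:R.
have N0 : 0 < N by rewrite ltr0n muln_gt0 expn_gt0 k0.
set Y := \sum_i y i ^+ 2.
have Y0 : 0 <= Y by apply: sumr_ge0 => i _; rewrite sqr_ge0.
have [Yz|Yn] := eqVneq Y 0.
  have yz i : y i = 0.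
    by apply/eqP; rewrite -sqrf_eq0; apply/eqP;
      apply: (psumr_eq0P _ Yz) => // j _; rewrite sqr_ge0.
  rewrite Yz mulr0 big1// => i _; rewrite big1// => j _.
  by rewrite !yz mulr0 mulr0.
have Ypos : 0 < Y by rewrite lt_def Yn.
pose l := Num.sqrt (N / Y).
have l2 : l ^+ 2 = N / Y by rewrite sqr_sqrtr// divr_ge0// ltW.
have l2pos : 0 < l ^+ 2 by rewrite l2 divr_gt0.
have ly : \sum_i (l * y i) ^+ 2 = N.
  by under eq_bigr do rewrite exprMn; rewrite -mulr_sumr l2 divfK.
rewrite -(ler_pM2l l2pos).
have -> : l ^+ 2 * (4 * eps * L * Y) = 4 * eps * L * N by rewrite l2; field.
have -> : l ^+ 2 * (\sum_i \sum_j (a G i j - edge_prob g p q i j *+ (i != j)) *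
  (y i * y j)) =
  \sum_i \sum_j (a G i j - edge_prob g p q i j *+ (i != j)) * ((l * y i) * (l *
    y j)).
  rewrite mulr_sumr; apply: eq_bigr => i _; rewrite mulr_sumr;
    apply: eq_bigr => j _; ring.
have tau0 : 0 < kappa * (k ^ 2)%:R * L by rewrite !mulr_gt0.
have D0 : 0 <= (C + alpha) * L by rewrite mulr_ge0 ?addr_ge0// ltW.
have cL0 : 0 <= c * L by rewrite mulr_ge0// ltW.
have r01 i j : 0 <= edge_prob g p q i j *+ (i != j) <= p.
  have /andP[r0 _] := edge_prob01 g p01 q01 i j.
  by rewrite mulrn_wge0//=; case: (i != j); rewrite // (edge_prob_le g qp).
have /andP[eta0 eta1] := eta01.
apply: (le_trans (quad_form_bound (r := fun i j => edge_prob g p q i j *+ (i != j))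
  (D := (C + alpha) * L) (E := eps * L) (c := c * L) k0 tau0 eta01 th0 cL0 D0 p_ge0
  _ r01 _ _ _ _ net ly)) => //.
- by move=> i j; rewrite adj_sym.
- by move=> i j; rewrite edge_prob_sym eq_sym.
- move=> i; rewrite big_split/= mulrDl lerD//.
  rewrite -npE; apply: (@le_trans _ _ (\sum_(j < n) p)).
    by apply: ler_sum => j _; case/andP: (r01 i j).
  by rewrite sumr_const card_ord mulr_natl.
- move=> U sU; apply: small; rewrite -(ler_pM2r k2R).
  apply: le_trans (le_trans sU _); last by rewrite natrM mulrC.
  by rewrite le_eqVlt; apply/orP; left; apply/eqP; ring.
rewrite ler_pM2r//.
have -> : p * (theta * n%:R + k%:R ^+ 2 * n%:R / (kappa * (k ^ 2)%:R * L) / theta) =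
  L * (alpha * theta + alpha / (kappa * theta * L)).
  have -> : p = alpha * L / n%:R by rewrite -npE mulrC mulKf// gt_eqF ?ltr0n.
  rewrite natrX; field.
  by rewrite !gt_eqF ?ltr0n.
have h1 := ler_wpM2l (ltW L_gt0) hk; have h2 := ler_wpM2l (ltW L_gt0) heta.
have h3 := ler_wpM2l (ltW L_gt0) hth.
have e1 : 2 * ((C + alpha) * L) / k%:R = L * (2 * (C + alpha) / k%:R) by ring.
have e2 : c * L / eta = L * (c / eta) by ring.
rewrite e1 e2; lra.
Qed.
End Concentration.

(** * The certificate holds with high probability *)

Section Limits.
Variable R : realType.

(** With [s = expR (- t)], the minimum of [alpha * (s - 1) + beta * (s^-1 - 1)] is at
    [s = sqrt beta / sqrt alpha], with value [- (sqrt alpha - sqrt beta) ^+ 2]. *)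
Lemma gap_exponent (alpha beta : R) : 0 <= beta ->
  Num.sqrt 2 < Num.sqrt alpha - Num.sqrt beta ->
  exists t delta : R, [/\ 0 < t, 0 < delta &
    alpha * (expR (- t) - 1) + beta * (expR t - 1) <= - 2 - 2 * delta].
Proof.
move=> b0 ab.
suff [s [/andP[s0 s1] hs]] : exists s, 0 < s < 1 /\
    alpha * (s - 1) + beta * (s^-1 - 1) < - 2.
  exists (- ln s), ((- 2 - (alpha * (s - 1) + beta * (s^-1 - 1))) / 2).
  rewrite opprK expRN lnK ?posrE//; split; last lra.
    by rewrite oppr_gt0 ln_lt0// s0.
  by rewrite divr_gt0// subr_gt0.
have sb0 : 0 <= Num.sqrt beta by apply: sqrtr_ge0.
have sa : Num.sqrt 2 < Num.sqrt alpha by lra.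
have a2 : 2 < alpha.
  by rewrite ltNge; apply/negP => /ler_wsqrtr; lra.
have sqa : Num.sqrt alpha ^+ 2 = alpha by rewrite sqr_sqrtr//; lra.
have sqb : Num.sqrt beta ^+ 2 = beta by rewrite sqr_sqrtr.
have [->|bn] := eqVneq beta 0.
  (* For [beta = 0] the minimizer degenerates to 0; this positive [s] gives
     [- alpha / 2 - 1 < - 2]. *)
  exists ((alpha - 2) / (2 * alpha)); have al0 : 0 < alpha by lra.
  have -> : (alpha - 2) / (2 * alpha) = 2^-1 - alpha^-1 by field; rewrite gt_eqF.
  have ia : 0 < alpha^-1 by rewrite invr_gt0.
  have ia2 : alpha^-1 < 2^-1 by rewrite ltf_pV2 ?posrE.
  have aia : alpha * alpha^-1 = 1 by rewrite divff// gt_eqF.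
  split; [lra|nra].
have sbp : 0 < Num.sqrt beta by rewrite sqrtr_gt0 lt_def bn.
set u := Num.sqrt alpha in sa sqa ab *; set v := Num.sqrt beta in sbp sqb ab *.
have s2 : 0 <= Num.sqrt (2 : R) by apply: sqrtr_ge0.
have up : 0 < u by lra.
exists (v / u); split; first by rewrite divr_gt0//= ltr_pdivrMr// mul1r; lra.
rewrite -sqa -sqb invf_div.
have -> : u ^+ 2 * (v / u - 1) + v ^+ 2 * (u / v - 1) = - (u - v) ^+ 2.
  by field; rewrite !gt_eqF.
rewrite ltrN2 -(sqr_sqrtr (_ : 0 <= 2 :> R))//.
by rewrite ltr_sqr ?nnegrE//; lra.
Qed.

Lemma expRN_small (c0 e : R) : 0 < c0 -> 0 < e ->
  exists L0, forall L, L0 <= L -> expR (- (c0 * L)) <= e.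
Proof.
move=> c00 e0; exists ((e * c0)^-1) => L LL.
have ec : 0 < e * c0 by rewrite mulr_gt0.
have L0 : 0 < L by apply: lt_le_trans LL; rewrite invr_gt0.
rewrite expRN -[e]invrK lef_pV2 ?posrE ?invr_gt0 ?expR_gt0//.
apply: le_trans (expR_ge1Dx _); apply: ler_wpDl => //.
rewrite mulrC -ler_pdivrMr//; apply: le_trans LL.
by rewrite invfM.
Qed.

Lemma sqr_le_expR (L : R) : 0 <= L -> L ^+ 2 / 4 <= expR L.
Proof.
move=> L0; have -> : expR L = expR (L / 2) ^+ 2.
  by rewrite -expRM_natl; congr expR; field.
have -> : L ^+ 2 / 4 = (L / 2) ^+ 2 by field.
rewrite ler_sqr ?nnegrE ?expR_ge0 ?divr_ge0//.
by apply: le_trans (expR_ge1Dx _); rewrite lerDr.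
Qed.

(** Four bad events get probability at most [e / 4] each. The threshold [L0] is chosen before [n]
    and [g]. *)
Lemma planted_dual_feasible (alpha beta e : R) : 0 <= beta ->
  Num.sqrt 2 < Num.sqrt alpha - Num.sqrt beta -> 0 < e ->
  exists L0 : R, 0 < L0 /\ forall n (g : signs n), (0 < n)%N -> ~~ odd n ->
    equal_clusters g -> L0 <= ln n%:R ->
    let p := alpha * (ln n%:R / n%:R) in let q := beta * (ln n%:R / n%:R) in
    [/\ 0 <= p <= 1, 0 <= q <= 1 &
    sbm_prob g p q (fun G => ~~ `[< strictly_dual_feasible R G g >]) <= e].
Proof.
move=> b0 regime e0.
have [t [delta [t0 delta0 ht]]] := gap_exponent b0 regime.
have ba : beta < alpha.
  rewrite ltNge; apply/negP => /ler_wsqrtr.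
  have := sqrtr_ge0 (2 : R); lra.
have a0 : 0 < alpha by exact: le_lt_trans ba.
(* Then [t * (5 * eps * L)] uses half of the gain [delta * L] in [gap_union]. *)
pose eps := delta / (10 * t).
have eps0 : 0 < eps by rewrite divr_gt0// mulr_gt0.
(* The exponent in [degree_union] becomes [- L]. *)
pose C := expR 1 * alpha + 2.
have C0 : 0 < C by rewrite addr_gt0// mulr_gt0 ?expR_gt0.
have Ca : 0 < C + alpha by rewrite addr_gt0.
pose k := (Num.truncn (2 * (C + alpha) / eps)).+1.
have k0 : (0 < k)%N by [].
have kR : 0 < k%:R :> R by rewrite ltr0n.
have hk : 2 * (C + alpha) / k%:R <= eps.
  rewrite ler_pdivrMr// -ler_pdivrMl// [leLHS]mulrC; apply: ltW.
  exact: (real_truncnS_gt (num_real _)).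
(* This keeps [2 * eta * (C + alpha)] below [eps / 2], and [c] is then set so that [c / eta] is the
   other half. *)
pose eta := eps / (4 * (C + alpha) + eps).
have den0 : 0 < 4 * (C + alpha) + eps by rewrite addr_gt0// mulr_gt0.
have eta0 : 0 < eta by rewrite divr_gt0.
have eta1 : eta <= 1 by rewrite ler_pdivrMr// mul1r lerDr mulr_ge0// ltW.
have eta01 : 0 < eta <= 1 by rewrite eta0.
pose c := eps * eta / 2.
have c0 : 0 < c by rewrite divr_gt0// mulr_gt0.
have heta : 2 * eta * (C + alpha) + c / eta <= eps.
  have -> : c / eta = eps / 2 by rewrite /c; field; rewrite gt_eqF.
  have : eta * (4 * (C + alpha) + eps) = eps by rewrite /eta divfK// gt_eqF.
  have := mulr_ge0 (ltW eta0) (ltW eps0); lra.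
pose K := (k ^ 2)%N.
(* The gain in [net_union] is then [(K + 4) * n] against [(K + 2) * n] for the lattice points; of
   the remaining [2 * n], the second-order term takes at most [n] once [L3 <= L]. *)
pose kappa := eps / (4 * (K%:R + 4)).
have K4 : 0 < K%:R + 4 :> R by rewrite ltr_wpDl.
have kappa0 : 0 < kappa by rewrite divr_gt0// mulr_gt0.
pose theta := eps / (2 * alpha).
have theta0 : 0 < theta by rewrite divr_gt0// mulr_gt0.
(* All four tails are at most [expR (1 - c1 * L)]. *)
pose c1 := Num.min (delta / 2) 1.
have c10 : 0 < c1 by rewrite lt_min divr_gt0//= ltr01.
have [L1 hL1] := @expRN_small c1 (e / (4 * expR 1)) c10 (divr_gt0 e0 (mulr_gt0
  (ltr0n _ 4) (expR_gt0 1))).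
pose s := eta ^+ 2 * kappa.
have s0 : 0 < s by rewrite mulr_gt0// exprn_gt0.
pose L2 := alpha * expR (6 / c) / (2 * s).
pose L3 := alpha / (4 * kappa ^+ 2).
pose L4 := 2 * alpha / (kappa * theta * eps).
pose L5 := 4 * (alpha + beta).
pose L0 := Num.max L1 (Num.max L2 (Num.max L3 (Num.max L4 (Num.max L5 1)))).
exists L0; split; first by rewrite !lt_max ltr01 !orbT.
move=> n g n0 evn clus; set L := ln n%:R.
rewrite !ge_max => /andP[LL1 /andP[LL2 /andP[LL3 /andP[LL4 /andP[LL5 LL6]]]]] p q.
have Lp : 0 < L by lra.
have nR : 0 < n%:R :> R by rewrite ltr0n.
have expL : expR L = n%:R by rewrite lnK// posrE.
have npE : n%:R * p = alpha * L by rewrite /p; field; rewrite gt_eqF.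
have nqE : n%:R * q = beta * L by rewrite /q; field; rewrite gt_eqF.
have Ln0 : 0 <= L / n%:R by rewrite divr_ge0 ?(ltW Lp) ?(ltW nR).
have q0 : 0 <= q by rewrite mulr_ge0.
have qp : q <= p by rewrite ler_wpM2r// ltW.
(* Equivalent to [(alpha + beta) * L <= n], which follows from [L ^+ 2 / 4 <= expR L] when
   [L5 <= L]. *)
have pq1 : p + q <= 1.
  rewrite -(ler_pM2l nR) mulrDr npE nqE mulr1 -expL.
  apply: le_trans (sqr_le_expR (ltW Lp)).
  have := ler_wpM2r (ltW Lp) LL5; rewrite /L5 expr2; lra.
have p0 : 0 <= p by apply: le_trans qp.
have p01 : 0 <= p <= 1 by rewrite p0 (le_trans _ pq1)// lerDl.
have q01 : 0 <= q <= 1 by rewrite q0 (le_trans _ pq1)// lerDr.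
split=> //.
pose bad1 (G : sgraph n) := [exists i, \sum_j (adj G i j)%:R * (sgn R g i * sgn
  R g j) <= 5 * eps * L].
pose bad2 (G : sgraph n) := [exists i, C * L <= \sum_j ((adj G i j)%:R : R)].
pose bad3 (G : sgraph n) := [exists U : {set 'I_n}, (#|U|%:R * (s * L) <= n%:R) &&
     (c * L * #|U|%:R < \sum_(i in U) \sum_(j in U) (adj G i j)%:R)].
pose bad4 (G : sgraph n) := `[< exists m : 'I_n -> bool * nat,
     [/\ forall i, signed_nat R (m i) ^+ 2 <= kappa * K%:R * L,
      \sum_i signed_nat R (m i) ^+ 2 <= (K * n)%:R &
      eps * L * (K * n)%:R < \sum_i \sum_j ((adj G i j)%:R - edge_prob g p q i
        j *+ (i != j)) *
        (signed_nat R (m i) * signed_nat R (m j))] >].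
have good G : ~~ `[< strictly_dual_feasible R G g >] ->
    [|| bad1 G, bad2 G, bad3 G | bad4 G].
  apply: contraR; rewrite 3!negb_or => /and4P[nb1 nb2 nb3 nb4]; apply/asboolP.
  (* The degree gaps exceed [5 * eps * L], while the centered form stays within [4 * eps * L]. *)
  have e4 : 4 * eps * L <= 5 * eps * L by rewrite !ler_wpM2r ?(ltW Lp) ?(ltW
    eps0)// ler_nat.
  apply: (strictly_dual_feasible_intro (T := 5 * eps * L) p0 pq1).
  - exact: equal_clusters_sum.
  - by move=> i; rewrite ltNge; apply: contra nb1 => h; apply/existsP; exists i.
  move=> y; have Y0 : 0 <= \sum_i y i ^+ 2 by rewrite sumr_ge0// => i _;
    rewrite sqr_ge0.
  apply: le_trans (ler_wpM2r Y0 e4).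
  apply: (quad_form_good n0 Lp q0 qp pq1 npE (ltW a0) k0 (ltW C0) eta01 c0
    kappa0 theta0) => //.
  - have al : alpha * theta = eps / 2 by rewrite /theta; field; rewrite gt_eqF.
    have : alpha / (kappa * theta * L) <= eps / 2; last by rewrite al; lra.
    have kt0 : 0 < kappa * theta by rewrite mulr_gt0.
    have d0 : 0 < kappa * theta * eps by rewrite mulr_gt0.
    rewrite ler_pdivrMr; last by rewrite mulr_gt0.
    have := LL4; rewrite /L4 ler_pdivrMr// => h; lra.
  - by move=> i; rewrite leNgt; apply: contra nb2 => h; apply/existsP; exists i;
    exact: ltW.
  - move=> U sU; rewrite leNgt; apply: contra nb3 => h; apply/existsP; exists U.
    by rewrite h andbT.
  move=> m m1 m2; rewrite leNgt; apply: contra nb4 => h; apply/asboolP.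
  by exists m.
have small (x : R) : x <= 1 - c1 * L -> expR x <= e / 4.
  move=> xL; apply: (@le_trans _ _ (expR 1 * expR (- (c1 * L)))).
    by rewrite -expRD ler_expR.
  apply: (le_trans (ler_wpM2l (expR_ge0 1) (hL1 L LL1))).
  rewrite le_eqVlt; apply/orP; left; apply/eqP; field.
  by rewrite gt_eqF ?expR_gt0.
have c1L : c1 * L <= L by rewrite ler_piMl ?(ltW Lp)// ge_min lexx orbT.
have c1dL : c1 * L <= delta / 2 * L by rewrite ler_wpM2r ?(ltW Lp)// ge_min lexx.
have P1 : sbm_prob g p q bad1 <= e / 4.
  apply: le_trans (small _ _);
    first exact: (gap_union expL q0 qp pq1 npE nqE _ evn clus (ltW t0)).
  have -> : t * (5 * eps * L) = delta / 2 * L by rewrite /eps; field;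
    rewrite gt_eqF.
  have L20 : 0 <= L / 2 by rewrite divr_ge0// ltW.
  have := ler_wpM2l L20 ht; lra.
have P2 : sbm_prob g p q bad2 <= e / 4.
  apply: le_trans (small _ _);
    first exact: (degree_union g expL q0 qp pq1 npE (C * L)).
  have -> : L - C * L + alpha * L * expR 1 = - L by rewrite /C; ring.
  lra.
have P3 : sbm_prob g p q bad3 <= e / 4.
  apply: le_trans (small _ _);
    first exact: (induced_edges_union g n0 Lp expL q0 qp pq1 npE s0 c0 LL2).
  lra.
have P4 : sbm_prob g p q bad4 <= e / 4.
  have tau0 : 0 < kappa * K%:R * L.
    by rewrite mulr_gt0// mulr_gt0// ltr0n expn_gt0.
  apply: le_trans (small _ _);
    first exact: (net_union g q0 qp pq1 K (eps * L * (K * n)%:R) tau0).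
  have Kn0 : K%:R != 0 :> R by rewrite pnatr_eq0 -lt0n expn_gt0.
  have -> : eps * L * (K * n)%:R / (4 * (kappa * K%:R * L)) = (K%:R + 4) * n%:R.
    rewrite /kappa natrM; field.
    by rewrite Kn0 !gt_eqF.
  have -> : p * ((K * n)%:R / (2 * (kappa * K%:R * L))) ^+ 2 = L3 / L * n%:R.
    have -> : p = alpha * L / n%:R by rewrite -npE mulrC mulKf// gt_eqF.
    rewrite /L3 natrM; field.
    by rewrite Kn0 !gt_eqF.
  have : L3 / L * n%:R <= n%:R.
    by rewrite ler_piMl ?(ltW nR)// ler_pdivrMr// mul1r.
  have : 1 + L <= n%:R by rewrite -expL; exact: expR_ge1Dx.
  lra.
apply: (le_trans (sbm_prob_le g p01 q01 good)).
apply: (le_trans (sbm_probU g p01 q01 _ _)).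
have h2 := sbm_probU g p01 q01 bad2 (fun G => bad3 G || bad4 G).
have h3 := sbm_probU g p01 q01 bad3 bad4.
lra.
Qed.
End Limits.

(** * Probabilities over the instance and the seed *)

Section RunProb.
Variables (R : realType) (In Seed : finType) (mu : In -> R) (nu : Seed -> R).
Hypotheses (pmf_mu : is_pmf mu) (pmf_nu : is_pmf nu).

Let mu_nu_ge0 G w : 0 <= mu G * nu w.
Proof. by rewrite mulr_ge0 ?pmf_mu.1 ?pmf_nu.1. Qed.

Let sum_seed_le (E : In -> Seed -> Prop) G :
  \sum_(w | `[< E G w >]) mu G * nu w <= mu G.
Proof.
rewrite -[leRHS]mulr1 -pmf_nu.2 mulr_sumr [leLHS]big_mkcond ler_sum// => w _.
by case: ifP.
Qed.

Lemma run_prob_le1 (E : In -> Seed -> Prop) : run_prob mu nu E <= 1.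
Proof. by rewrite -pmf_mu.2 ler_sum. Qed.

(** On an instance that is not [good], the seeds together weigh at most [mu G]. *)
Lemma run_prob_le_add (E F : In -> Seed -> Prop) (good : pred In) :
  (forall G w, good G -> E G w -> F G w) ->
  run_prob mu nu E <= run_prob mu nu F + \sum_(G | ~~ good G) mu G.
Proof.
move=> EF; rewrite /run_prob [X in _ + X]big_mkcond -big_split/= ler_sum// => G _.
have [gG|bG] := boolP (good G); last first.
  by apply: ler_wpDl; [rewrite sumr_ge0|exact: sum_seed_le].
rewrite addr0 big_mkcond [leRHS]big_mkcond ler_sum// => w _.
case: ifP => [/asboolP Ew|_]; last by case: ifP.
by rewrite ifT//; apply/asboolP/EF.
Qed.
End RunProb.

Local Open Scope classical_set_scope.
Local Open Scope ring_scope.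

Theorem proposition2p3 (R : realType) (alpha beta : R)
    (g : forall n : nat, signs n)
    (Seed : nat -> finType) (nu : forall n : nat, Seed n -> R)
    (abbe_sandon : forall n : nat, sgraph n -> Seed n -> signs n)
    (beta_ge0 : 0 <= beta)
    (regime : Num.sqrt 2 < Num.sqrt alpha - Num.sqrt beta)
    (clusters : forall n : nat, even_sizes n -> equal_clusters (g n))
    (seed_law : forall n : nat, is_pmf (nu n))
    (abbe_sandon_whp : probabilistic_algorithm even_sizes
       (sbm_log alpha beta g) nu (@min_bisection R) abbe_sandon) :
  PCC_algorithm even_sizes (sbm_log alpha beta g) nu (@min_bisection R)
    (certified_algorithm R abbe_sandon).
Proof.
(* A certificate is sound for every graph and seed, so only the high-probability claim remains. *)
split; last by move=> n G w _ /= /certifies_min_bisection.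
apply/cvgrPdist_lt => e e0; have e2 : 0 < e / 2 by rewrite divr_gt0.
have [L0 [L0_gt0 feasible]] := planted_dual_feasible beta_ge0 regime e2.
have large : \forall n \near within even_sizes \oo, expR L0 <= n%:R.
  by apply: cvg_within; exact: nbhs_infty_ger.
move/cvgrPdist_lt : abbe_sandon_whp => /(_ _ e2) found.
near=> n.
have evn : even_sizes n by near: n; exact: withinT.
have nL0 : expR L0 <= n%:R by near: n.
have n0 : (0 < n)%N.
  by rewrite -(ltr_nat R); apply: lt_le_trans nL0; exact: expR_gt0.
have L0n : L0 <= ln n%:R by rewrite -(expRK L0) ler_ln ?posrE ?expR_gt0 ?ltr0n.
have [p01 q01 bad] := feasible n (g n) n0 evn (clusters n evn) L0n.
(* Available only for large [n], where [p] and [q] lie in the unit interval. *)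
have pmf : is_pmf (@sbm_log R alpha beta g n).
  by split=> [G|]; [exact: sbm_pmf_ge0|exact: sbm_pmf_sum1].
have run1 : `|1 - run_prob (@sbm_log R alpha beta g n) (nu n)
    (fun G w => min_bisection R G (abbe_sandon n G w))| < e / 2 by near: n.
set run := run_prob _ _ _.
have run_le1 : run <= 1 by exact: run_prob_le1.
have run_ge := run_prob_le_add pmf (seed_law n)
  (E := fun G w => min_bisection R G (abbe_sandon n G w))
  (F := fun G w => min_bisection R G (certified_algorithm R abbe_sandon G w).1 /\
     (certified_algorithm R abbe_sandon G w).2 = true)
  (good := fun G => `[< strictly_dual_feasible R G (g n) >]).
rewrite ger0_norm ?subr_ge0//.
have := run_ge _; rewrite -/run => /(_ _)/= h.
(* Half of [e] covers graphs whose planted signs are not strictly dual feasible; the other half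
   covers failures of [abbe_sandon]. *)
have : run_prob (@sbm_log R alpha beta g n) (nu n)
    (fun G w => min_bisection R G (abbe_sandon n G w)) <= run + e / 2.
  apply: le_trans (h _) _; last by rewrite lerD2l.
  move=> G w /asboolP feas opt; split=> //=.
  exact: min_bisection_certifies n0 evn (equal_clusters_bisection R (clusters n
    evn)) feas opt.
have := ler_norm (1 - run_prob (@sbm_log R alpha beta g n) (nu n)
    (fun G w => min_bisection R G (abbe_sandon n G w))).
lra.
Unshelve. all: by end_near.
Qed.
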